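(* Let $\Omega\subset\mathbb R^n$ be a bounded convex domain, let $x\in\Omega$, let $\mu\in J_x^\partial$, and let $f\in C(\overline\Omega)$, $f\ge 0$. Then Jensen stresses for $(x,\mu)$ exist. Moreover, if $\Gamma=G\,dx+\Gamma_s$ is the Lebesgue decomposition (absolutely continuous part $G\,dx$, singular part $\Gamma_s$) of any Jensen stress for $(x,\mu)$ and $u\in C^2(\overline\Omega)$ is convex with $\det D^2u\ge f$, then $$\int_{\partial\Omega}u\,d\mu-u(x)\ \ge\ n\int_\Omega f^{1/n}\det(G)^{1/n}\,dx .$$ Consequently the same lower bound holds for the smooth deficit, i.e. for $$\inf\Big\{\int_{\partial\Omega}u\,d\mu-u(x):\ u\in C^2(\overline\Omega)\text{ convex},\ \det D^2u\ge f\Big\}.$$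
   Context: $J_x^\partial$ is the set of Borel probability measures $\mu$ on $\partial\Omega$ with barycenter $\int_{\partial\Omega}y\,d\mu(y)=x$. A Jensen stress for $(x,\mu)$ is a positive semidefinite symmetric matrix-valued measure $\Gamma=(\Gamma_{ij})$ on $\Omega$ such that $$\int_{\partial\Omega}\phi\,d\mu-\phi(x)=\int_\Omega D^2\phi:d\Gamma\qquad\text{for every }\phi\in C^2(\overline\Omega),$$ where $A:B=\operatorname{tr}(AB)$, so that $\int_\Omega D^2\phi:d\Gamma=\sum_{i,j}\int_\Omega\frac{\partial^2\phi}{\partial x_i\partial x_j}\,d\Gamma_{ij}$. *)

(* Defs.v *)
From HB Require Import structures.
From mathcomp Require Import all_boot all_order all_algebra.
From mathcomp Require Import all_classical all_reals all_analysis.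

Set Implicit Arguments.
Unset Strict Implicit.
Unset Printing Implicit Defensive.

Import Order.TTheory GRing.Theory Num.Theory.
Import numFieldNormedType.Exports.

Local Open Scope classical_set_scope.
Local Open Scope ring_scope.

(** Points of R^n are row vectors; their sigma-algebra is the Borel one. *)
HB.instance Definition _ (R : realType) (n : nat) :=
  @isMeasurable.Build default_measure_display 'rV[R]_n
    <<s @open 'rV[R]_n >> (@sigma_algebra0 _ _ _)
    (@sigma_algebraC _ _) (@sigma_algebra_bigcup _ _ _).

(** Lebesgue measure on R^n.  R^0 is a point of mass 1 and R^(n+1) is
    identified with R * R^n. *)
Section lebesgue_rV.
Context (R : realType).

Definition rV_cons (n : nat) (p : measurableTypeR R * 'rV[R]_n) : 'rV[R]_n.+1 :=
  row_mx (p.1)%:M p.2 : 'rV[R]_(1 + n).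

Definition rV_uncons (n : nat) (v : 'rV[R]_n.+1) : measurableTypeR R * 'rV[R]_n :=
  (v 0 0, rsubmx (v : 'rV[R]_(1 + n))).

Lemma rV_consE0 n p : @rV_cons n p 0 0 = p.1.
Proof.
have -> : (0 : 'I_n.+1) = lshift n (0 : 'I_1) by apply/val_inj.
by rewrite /rV_cons (@row_mxEl _ 1 1 n) mxE eqxx mulr1n.
Qed.

Lemma rV_consES n p j : @rV_cons n p 0 (rshift 1 j) = p.2 0 j.
Proof. by rewrite /rV_cons (@row_mxEr _ 1 1 n). Qed.

Lemma rV_consK n : cancel (@rV_cons n) (@rV_uncons n).
Proof.
move=> [t v]; rewrite /rV_uncons rV_consE0; congr pair.
exact: (@row_mxKr _ 1 1 n).
Qed.

Lemma open_measurable_rV n (U : set 'rV[R]_n) : open U -> measurable U.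
Proof. exact: sub_sigma_algebra. Qed.

Lemma continuous_measurable_rV n (f : 'rV[R]_n -> R) :
  continuous f -> measurable_fun [set: 'rV[R]_n] f.
Proof.
move=> cf; move=> mD; apply: (measurability _ (measurable_realfun.RGenOpens.measurableE R)) => // _ [_ [a [b ->] <-]].
rewrite setTI; apply: open_measurable_rV.
by apply: open_comp; [move=> ? _; exact: cf | exact: interval_open].
Qed.

Lemma rV_cons_measurable n : measurable_fun setT (@rV_cons n).
Proof.
apply: (measurability (@open 'rV[R]_n.+1)) => // _ [U oU <-].
rewrite setTI.
pose B (c : 'rV[rat]_n.+1 * nat) : set 'rV[R]_n.+1 :=
  ball (map_mx ratr c.1 : 'rV[R]_n.+1) (c.2.+1%:R^-1).
have -> : U = \bigcup_(c in [set c | B c `<=` U]) B c.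
  apply/seteqP; split=> [v Uv|v [c cU /cU//]].
  have /nbhs_ballP[e /= e0 veU] : nbhs v U by move: oU; rewrite openE; exact.
  have [k ke] : exists k : nat, k.+1%:R^-1 < e / 2 :> R.
    have e20 : 0 < e / 2 by rewrite divr_gt0.
    exists (Num.truncn (e / 2)^-1).
    rewrite invf_plt ?posrE// ?ltr0n//.
    by rewrite truncnS_gt.
  have k0 : 0 < k.+1%:R^-1 :> R by rewrite invr_gt0 ltr0n.
  have Hq (i : 'I_n.+1) : exists q : rat, `|v 0 i - ratr q| < k.+1%:R^-1.
    have [q] := @rat_in_itvoo R (v 0 i - k.+1%:R^-1) (v 0 i + k.+1%:R^-1)
      (ltac:(by rewrite ltrD2l gtrN)).
    rewrite in_itv/= => /andP[q1 q2]; exists q.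
    rewrite ltr_distl; apply/andP; split; [by rewrite ltrBlDr | by rewrite -ltrBlDr].
  pose q := \row_i projT1 (cid (Hq i)) : 'rV[rat]_n.+1.
  have Bv : ball (map_mx ratr q : 'rV[R]_n.+1) (k.+1%:R^-1) v.
    split=> // i j; rewrite !mxE ord1 /ball/= distrC.
    exact: (projT2 (cid (Hq j))).
  exists (q, k) => //= w Bw; apply: veU.
  have := ball_triangle (ball_sym Bv) Bw.
  by apply: le_ball; rewrite [leRHS](splitr e) lerD// ltW.
rewrite bigcup_mkcond preimage_bigcup.
apply: countable_bigcupT_measurable => [|[c k]]; first exact: countableP.
case: ifPn => _; last by rewrite preimage_set0.
have -> : @rV_cons n @^-1` B (c, k) =
    ball (ratr (c 0 0) : R) (k.+1%:R^-1) `*`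
    ball (map_mx ratr (rsubmx (c : 'rV_(1 + n))) : 'rV[R]_n) (k.+1%:R^-1).
  have e0 : 0 < k.+1%:R^-1 :> R by rewrite invr_gt0 ltr0n.
  apply/seteqP; split=> [[t w] [_ tw]|[t w] [/= bt [_ bw]]].
    split; first by have := tw 0 0; rewrite mxE rV_consE0.
    by split=> // i j; have := tw 0 (rshift 1 j); rewrite rV_consES !mxE ord1.
  split=> // i j; rewrite mxE ord1.
  case: (unliftP 0 j) => [j'|] ->; last by rewrite rV_consE0.
  have -> : lift 0 j' = rshift 1 j' by apply/val_inj.
  by have := bw 0 j'; rewrite rV_consES !mxE.
apply: measurableX; first exact: measurable_realfun.measurable_ball.
by apply: open_measurable_rV; exact: ball_open.
Qed.

Lemma rV_uncons_measurable n : measurable_fun setT (@rV_uncons n).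
Proof.
apply/measurable_fun_pairP; split.
  by apply: continuous_measurable_rV; exact: coord_continuous.
apply: (measurability (@open 'rV[R]_n)) => // _ [U oU <-].
rewrite setTI; apply: open_measurable_rV; apply: open_comp => // v _.
exact: (@continuous_rsubmx R 1 1 n).
Qed.

Section lebesgue_rVS.
Context (n : nat) (m : {sigma_finite_measure set 'rV[R]_n -> \bar R}).

Definition lebesgue_rVS : set 'rV[R]_n.+1 -> \bar R :=
  pushforward (@lebesgue_measure R \x m)%E (@rV_cons n).

Let rV_cons_setI A : measurable A -> measurable (@rV_cons n @^-1` A).
Proof. by move=> mA; rewrite -[X in measurable X]setTI; exact: rV_cons_measurable. Qed.

Let lebesgue_rVS0 : lebesgue_rVS set0 = 0%E.
Proof. by rewrite /lebesgue_rVS /pushforward preimage_set0 measure0. Qed.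

Let lebesgue_rVS_ge0 A : (0 <= lebesgue_rVS A)%E.
Proof. by rewrite /lebesgue_rVS /pushforward measure_ge0. Qed.

Let lebesgue_rVS_sigma_additive : semi_sigma_additive lebesgue_rVS.
Proof.
move=> F mF tF mUF; rewrite /lebesgue_rVS /pushforward preimage_bigcup.
apply: measure_semi_sigma_additive.
- by move=> k; exact: rV_cons_setI.
- apply/trivIsetP => /= i j _ _ ij; rewrite -preimage_setI.
  by move/trivIsetP : tF => /(_ _ _ _ _ ij) ->//; rewrite preimage_set0.
- by rewrite -preimage_bigcup; exact: rV_cons_setI.
Qed.

HB.instance Definition _ := isMeasure.Build _ _ _ lebesgue_rVS
  lebesgue_rVS0 lebesgue_rVS_ge0 lebesgue_rVS_sigma_additive.

Let lebesgue_rVS_sigma_finite : sigma_finite setT lebesgue_rVS.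
Proof.
have /sigma_finiteP[F [TF ndF Foo]] := sigma_finiteT (@lebesgue_measure R).
have /sigma_finiteP[G [TG ndG Goo]] := sigma_finiteT m.
exists (fun k => @rV_uncons n @^-1` (F k `*` G k)).
  apply/seteqP; split=> // v _.
  have [i _ Fi] : (\bigcup_i F i) (rV_uncons v).1 by rewrite -TF.
  have [j _ Gj] : (\bigcup_i G i) (rV_uncons v).2 by rewrite -TG.
  exists (maxn i j) => //; split.
    by move: Fi; exact/subsetPset/ndF/leq_maxl.
  by move: Gj; exact/subsetPset/ndG/leq_maxr.
move=> k; have [mF Fk] := Foo k; have [mG Gk] := Goo k; split.
  rewrite -[X in measurable X]setTI; apply: rV_uncons_measurable => //.
  exact: measurableX.
rewrite /lebesgue_rVS /pushforward -comp_preimage.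
have /funext -> : @rV_uncons n \o @rV_cons n =1 id by exact: rV_consK.
by rewrite preimage_id product_measure1E// lte_mul_pinfty// ge0_fin_numE.
Qed.

HB.instance Definition _ := Measure_isSigmaFinite.Build _ _ _ lebesgue_rVS
  lebesgue_rVS_sigma_finite.

End lebesgue_rVS.

Fixpoint lebesgue_rV (n : nat) : {sigma_finite_measure set 'rV[R]_n -> \bar R} :=
  if n is n'.+1 then lebesgue_rVS (lebesgue_rV n') else \d_(0 : 'rV[R]_0).

Lemma lebesgue_rV_box n (a b : 'I_n -> R) : (forall i, a i <= b i) ->
  lebesgue_rV n [set v : 'rV[R]_n | forall i, v 0 i \in `[a i, b i]] =
  (\prod_(i < n) (b i - a i))%:E.
Proof.
elim: n a b => [|n IHn] a b ab /=.
  by rewrite big_ord0 diracE mem_set// => -[].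
have -> : lebesgue_rVS (lebesgue_rV n) [set v : 'rV[R]_n.+1 | forall i, v 0 i \in `[a i, b i]] =
    ((@lebesgue_measure R \x lebesgue_rV n)%E (`[a ord0, b ord0]%classic `*`
    [set v : 'rV[R]_n | forall i, v 0 i \in `[a (lift ord0 i), b (lift ord0 i)]])).
  rewrite /lebesgue_rVS /pushforward; congr product_measure1.
  have liftE (j : 'I_n) : lift ord0 j = rshift 1 j by apply/val_inj.
  apply/seteqP; split=> [[t v] /= tv|[t v] /= [tI vI] i].
    split; first by have := tv 0; rewrite rV_consE0.
    by move=> i; have := tv (lift ord0 i); rewrite {1}liftE rV_consES.
  case: (unliftP ord0 i) => [j|] ->; last by rewrite rV_consE0.
  by rewrite {1}liftE rV_consES.
rewrite product_measure1E//=; last first.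
  rewrite [X in measurable X](_ : _ =
    \bigcap_(i in [set: 'I_n]) ((fun v : 'rV[R]_n => v 0 i) @^-1`
      `[a (lift ord0 i), b (lift ord0 i)]%classic)); last first.
    by apply/seteqP; split=> [v vI i _|v vI i]; [exact: vI|exact: (vI i I)].
  apply: fin_bigcap_measurable => // i _; rewrite -[X in measurable X]setTI.
  by apply: continuous_measurable_rV => //; exact: coord_continuous.
rewrite IHn; last by move=> i; exact: ab.
rewrite lebesgue_measure_itv/= lte_fin big_ord_recl EFinM; congr (_ * _)%E.
case: ltgtP (ab ord0) => // ->; by rewrite subrr.
Qed.

End lebesgue_rV.

(** The Hahn decomposition is only unique up to null sets; the integral below
    does not depend on the chosen one. *)
Section charge_integral.
Context d (T : measurableType d) (R : realType).
Variable nu : {charge set T -> \bar R}.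

Definition hahn_pos : set T := sval (cid (Hahn_decomposition nu)).

Definition hahn_neg : set T := sval (cid (svalP (cid (Hahn_decomposition nu)))).

Lemma hahn_pos_neg : hahn_decomposition nu hahn_pos hahn_neg.
Proof. exact: svalP (cid (svalP (cid (Hahn_decomposition nu)))). Qed.

Definition charge_integral (D : set T) (f : T -> \bar R) : \bar R :=
  (\int[jordan_pos hahn_pos_neg]_(y in D) f y -
   \int[jordan_neg hahn_pos_neg]_(y in D) f y)%E.

End charge_integral.

Section calculus.
Context (R : realType) (n : nat).
Implicit Types (Omega : set 'rV[R]_n) (u : 'rV[R]_n -> R).

Definition bounded_convex_domain Omega : Prop :=
  [/\ open Omega, Omega !=set0, bounded_set Omega & convex_set Omega].

Definition boundary Omega : set 'rV[R]_n := closure Omega `\` interior Omega.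

Definition partial (i : 'I_n) u : 'rV[R]_n -> R := 'D_(delta_mx 0 i) u.

Definition hessian u (y : 'rV[R]_n) : 'M[R]_n :=
  \matrix_(i, j) partial i (partial j u) y.

Definition extends_to_closure Omega (g : 'rV[R]_n -> R) : Prop :=
  exists2 h : 'rV[R]_n -> R,
    {within closure Omega, continuous h} & {in Omega, g =1 h}.

(** C^2 of the closure of an open set: functions continuous on the closure
    whose partial derivatives of order 1 and 2 exist in the open set and extend
    continuously to the closure.  Values outside the closure are irrelevant. *)
Definition C2_closure Omega u : Prop :=
  [/\ {within closure Omega, continuous u},
      forall i, {in Omega, forall y, derivable u y (delta_mx 0 i)} /\
        extends_to_closure Omega (partial i u) &
      forall i j, {in Omega, forall y,
          derivable (partial j u) y (delta_mx 0 i)} /\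
        extends_to_closure Omega (partial i (partial j u))].

End calculus.

Section jensen.
Context (R : realType) (n : nat).
Implicit Types (Omega : set 'rV[R]_n) (x : 'rV[R]_n) (f : 'rV[R]_n -> R).
Implicit Types (mu : probability 'rV[R]_n R).

(** Measures on the boundary (resp. on [Omega]) are measures on the whole space
    that are carried by the boundary (resp. by [Omega]). *)
Definition jensen_boundary Omega x : set (probability 'rV[R]_n R) :=
  [set mu | mu (boundary Omega) = 1%E /\
    forall i, (\int[mu]_(y in boundary Omega) (y 0 i)%:E = (x 0 i)%:E)%E].

Definition psd (A : 'M[R]_n) : Prop :=
  A^T = A /\ forall v : 'rV[R]_n, 0 <= (v *m A *m v^T) 0 0.

Definition matrix_charge := 'I_n -> 'I_n -> {charge set 'rV[R]_n -> \bar R}.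
Implicit Types (Gamma : matrix_charge).

Definition carried_by Omega Gamma : Prop :=
  forall i j A, measurable A -> A `&` Omega = set0 -> Gamma i j A = 0%E.

Definition psd_measure Gamma : Prop :=
  forall A, measurable A -> psd (\matrix_(i, j) fine (Gamma i j A)).

Definition jensen_gap Omega x mu (u : 'rV[R]_n -> R) : \bar R :=
  (\int[mu]_(y in boundary Omega) (u y)%:E - (u x)%:E)%E.

Definition jensen_stress Omega x mu Gamma : Prop :=
  [/\ carried_by Omega Gamma, psd_measure Gamma &
    forall phi, C2_closure Omega phi ->
      jensen_gap Omega x mu phi =
      (\sum_(i < n) \sum_(j < n)
        charge_integral (Gamma i j) Omega (fun y => (hessian phi y i j)%:E))%E].

Definition singular_measure Gamma : Prop :=
  exists N : set 'rV[R]_n, [/\ measurable N, lebesgue_rV R n N = 0%E &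
    forall i j A, measurable A -> A `&` N = set0 -> Gamma i j A = 0%E].

Definition lebesgue_decomposition Omega Gamma
    (G : 'rV[R]_n -> 'M[R]_n) (Gammas : matrix_charge) : Prop :=
  [/\ forall i j, (lebesgue_rV R n).-integrable Omega (fun y => (G y i j)%:E),
      singular_measure Gammas &
      forall i j A, measurable A -> (Gamma i j A =
        \int[lebesgue_rV R n]_(y in A `&` Omega) (G y i j)%:E + Gammas i j A)%E].

Definition admissible Omega f : set ('rV[R]_n -> R) :=
  [set u | [/\ C2_closure Omega u, convex_function (closure Omega) u &
    {in Omega, forall y, f y <= \det (hessian u y)}]].

Definition smooth_deficit Omega x mu f : \bar R :=
  ereal_inf [set jensen_gap Omega x mu u | u in admissible Omega f].

End jensen.

(* Main.v *)
From HB Require Import structures.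
Require Import Defs.
From mathcomp Require Import all_boot all_order all_algebra.
From mathcomp Require Import all_classical all_reals all_analysis.
From mathcomp Require Import measurable_realfun ring lra.

Set Implicit Arguments.
Unset Strict Implicit.
Unset Printing Implicit Defensive.

Import Order.TTheory GRing.Theory Num.Theory.
Import numFieldNormedType.Exports.

Local Open Scope classical_set_scope.
Local Open Scope ring_scope.

(**
Existence: Taylor's formula with integral remainder along the segment from [x]
to [y], integrated against [mu], loses its first order term because [x] is the
barycenter of [mu].  Hence the pushforward of
[(1 - t) (y - x)^T (y - x) dt dmu(y)] under [(t, y) |-> x + t (y - x)] is a
Jensen stress.

Lower bound: the stress charges [D^2 u], and both parts of its Lebesgue
decomposition are psd.  The singular part contributes a nonnegative amount:
by Radon-Nikodym it has a psd density with respect to a scalar measure.  For the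
absolutely continuous part, [tr (A B) >= n (det A det B)^(1/n)] for psd [A] and
[B]: a Cholesky factorization of [A] reduces this to a single psd matrix, where
it is Hadamard's inequality followed by the AM-GM inequality on the diagonal.
*)

(** * Positive semidefinite matrices *)

(** Two obstacles shape the proof. [C2_closure] supplies only coordinate derivatives inside [Omega],
    with continuous extensions to the closure, while Taylor's formula runs along segments that end
    on the boundary. Derivatives in arbitrary directions and the symmetry of the Hessian are
    therefore rebuilt from the mean value theorem, and derivatives are replaced by continuous
    functions on the whole space (Tietze), bounded in the case of the Hessian, which also settles
    measurability and integrability. The endpoint [t = 1] is left out, so that the segments stay in
    [Omega]. On the measure side, [charge_integral] refers to a chosen Hahn decomposition, which
    neither sums nor pushforwards respect. The remedy is that every representation of a charge as a
    difference of finite measures yields the same integral of a bounded function. Both parts of the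
    Lebesgue decomposition inherit positivity from the stress by intersecting with, or removing, a
    null set that carries the singular part; for the density this gives psd values only almost
    everywhere. *)

Section psd_matrices.
Context {R : realType}.

Lemma quad_formE n (A : 'M[R]_n) (v : 'rV[R]_n) :
  (v *m A *m v^T) 0 0 = \sum_i \sum_j v 0 i * A i j * v 0 j.
Proof.
rewrite mxE exchange_big/=; apply: eq_bigr => j _.
by rewrite !mxE mulr_suml.
Qed.

Lemma psd_diag_ge0 n (A : 'M[R]_n) i : psd A -> 0 <= A i i.
Proof.
case=> _ /(_ (delta_mx 0 i)); rewrite -rowE trmx_delta.
by rewrite -colE !mxE.
Qed.

Lemma psd_congr n m (A : 'M[R]_n) (P : 'M[R]_(m, n)) :
  psd A -> psd (P *m A *m P^T).
Proof.
case=> At A0; split; first by rewrite !trmx_mul trmxK At mulmxA.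
by move=> v; have := A0 (v *m P); rewrite trmx_mul !mulmxA.
Qed.

(** With a zero diagonal entry, the form on [t e_i + e_j] is affine in [t] with slope [2 A i j], so
    a nonzero slope would make it negative somewhere. *)
Lemma psd_diag0 n (A : 'M[R]_n) i j : psd A -> A i i = 0 -> A i j = 0.
Proof.
move=> [At A0] Aii.
have Aji : A j i = A i j by rewrite -{1}At mxE.
apply/eqP/negPn/negP => Aij.
(* Solves [2 t A i j + A j j = -1]. *)
pose t : R := - (A j j + 1) / (2 * A i j).
have := A0 (t *: delta_mx 0 i + delta_mx 0 j).
rewrite [(_ + _)^T]linearD/= [(_ *: _)^T]linearZ/= !mulmxDl !mulmxDr.
rewrite -!scalemxAl -!scalemxAr.
have mxD (M N : 'M[R]_1) : (M + N) 0 0 = M 0 0 + N 0 0 by rewrite mxE.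
have mxZ c (M : 'M[R]_1) : (c *: M) 0 0 = c * M 0 0 by rewrite mxE.
rewrite !(mxD, mxZ).
have E k l : ((delta_mx 0 k : 'rV_n) *m A *m (delta_mx 0 l : 'rV_n)^T) 0 0 = A k l.
  by rewrite -rowE trmx_delta -colE !mxE.
rewrite !E Aii Aji.
have -> : t * (t * 0) + t * A i j + (t * A i j + A j j) = - 1.
  rewrite mulr0 mulr0 add0r /t.
  by field.
by rewrite ler0N1.
Qed.

Section schur_complement.
Context (n : nat) (a : R) (b : 'rV[R]_n) (D : 'M[R]_n).

Definition schur := D - a^-1 *: (b^T *m b).

(** Block elimination of the first column: the left factor is lower unitriangular, so the
    determinant is that of the right one. *)
Lemma det_schur : a != 0 ->
  \det (block_mx a%:M b b^T D : 'M[R]_(1 + n)) = a * \det schur.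
Proof.
move=> a0.
have -> : block_mx a%:M b b^T D =
    (block_mx 1%:M 0 (a^-1 *: b^T) 1%:M : 'M[R]_(1 + n)) *m block_mx a%:M b 0 schur.
  rewrite mulmx_block !mul1mx !mul0mx !addr0.
  congr block_mx; first by rewrite mul_mx_scalar scalerA divff// scale1r.
  by rewrite -scalemxAl addrC subrK.
by rewrite det_mulmx det_lblock !det1 !mul1r det_ublock det_scalar1.
Qed.

(** For fixed [w], the first coordinate [- a^-1 w b^T] minimizes the form of the block matrix, and
    the minimum is the form of [schur] at [w]. *)
Lemma psd_schur : 0 < a -> psd (block_mx a%:M b b^T D : 'M[R]_(1 + n)) -> psd schur.
Proof.
move=> a0 [At A0].
have Dt : D^T = D.
  move: At; rewrite tr_block_mx => /eq_block_mx[_ _ _ ->//].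
split.
  by rewrite linearB/= linearZ/= trmx_mul trmxK Dt.
move=> w; have := A0 (row_mx (- a^-1 *: (w *m b^T)) w : 'rV[R]_(1 + n)).
rewrite mul_row_block tr_row_mx mul_row_col.
rewrite mul_mx_scalar scalerA mulrN divff ?gt_eqF// scaleN1r addNr mul0mx add0r.
rewrite mulmxDl /schur mulmxBr mulmxBl.
rewrite -!scalemxAl -scalemxAr -scalemxAl scaleNr !mulmxA.
by rewrite addrC.
Qed.

End schur_complement.

Lemma psd_block n (A : 'M[R]_(1 + n)) : psd A ->
  exists a b D, A = block_mx a%:M b b^T D /\ psd D.
Proof.
move=> pA; exists (A 0 0), (ursubmx A), (drsubmx A).
case: (pA) => At _; split; last first.
  have -> : drsubmx A = row_mx 0 1%:M *m A *m (row_mx 0 1%:M)^T.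
    rewrite -{2}[A]submxK mul_row_block tr_row_mx mul_row_col.
    by rewrite !mul0mx !mul1mx !add0r trmx0 mulmx0 add0r trmx1 mulmx1.
  exact: psd_congr.
rewrite -[LHS]submxK; congr block_mx.
- rewrite [LHS]mx11_scalar; congr (_%:M).
  by rewrite !mxE; congr (A _ _); apply/val_inj.
- by rewrite trmx_ursub At.
Qed.

Lemma psd_block0 n (b : 'rV[R]_n) D :
  psd (block_mx (0%:M) b b^T D : 'M[R]_(1 + n)) -> b = 0.
Proof.
move=> pA; apply/rowP => j; rewrite mxE.
have := @psd_diag0 _ _ (lshift n 0) (rshift 1 j) pA.
by rewrite block_mxEul block_mxEur mxE eqxx mulr1n; exact.
Qed.

(** Induction on the size. A zero pivot forces its whole row to vanish, so a factor of the trailing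
    block is enough; a positive pivot is eliminated and the induction hypothesis is applied to the
    Schur complement. *)
Lemma cholesky n (A : 'M[R]_n) : psd A -> exists L : 'M[R]_n, A = L *m L^T.
Proof.
elim: n A => [|n IHn] A pA; first by exists 0; rewrite [A]flatmx0 [RHS]flatmx0.
have [a [b [D [AE pD]]]] := @psd_block n A pA.
have a_ge0 : 0 <= a.
  have := psd_diag_ge0 (lshift n (0 : 'I_1)) pA.
  by rewrite AE block_mxEul mxE eqxx mulr1n.
have [a0|a0] := eqVneq a 0.
  have b0 : b = 0 by apply: (@psd_block0 _ _ D); rewrite -a0 -AE.
  have [L DL] := IHn _ pD.
  exists (block_mx 0 0 0 L : 'M[R]_(1 + n)).
  rewrite AE (@tr_block_mx _ 1 n 1 n) (@mulmx_block _ 1 n 1 n 1 n).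
  by rewrite !trmx0 !mulmx0 !mul0mx !addr0 add0r -DL a0 b0 trmx0 raddf0.
have {}a0 : 0 < a by rewrite lt_neqAle eq_sym a0.
have [L SL] : exists L : 'M[R]_n, schur a b D = L *m L^T.
  by apply: IHn; apply: psd_schur => //; rewrite -AE.
pose s := Num.sqrt a.
have s0 : s != 0 by rewrite sqrtr_eq0 -ltNge.
have ss : s * s = a by rewrite -expr2 sqr_sqrtr.
exists (block_mx s%:M 0 (s^-1 *: b^T) L : 'M[R]_(1 + n)).
rewrite AE (@tr_block_mx _ 1 n 1 n) (@mulmx_block _ 1 n 1 n 1 n).
rewrite !trmx0 !mulmx0 !mul0mx !addr0 tr_scalar_mx -SL.
rewrite !linearZ/= trmxK !mul_scalar_mx mul_mx_scalar !scalerA mulfV// !scale1r.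
rewrite mulVf// scale1r scale_scalar_mx ss -scalemxAl scalerA -invfM ss.
by rewrite /schur addrC subrK.
Qed.

(** Hadamard's inequality, by the same induction: the determinant is the pivot times that of the
    Schur complement, whose diagonal is dominated by that of [D]. *)
Lemma psd_det_le_prod n (A : 'M[R]_n) : psd A ->
  0 <= \det A <= \prod_i A i i.
Proof.
elim: n A => [|n IHn] A pA; first by rewrite det_mx00 big_ord0 ler01 lexx.
have [a [b [D [AE pD]]]] := @psd_block n A pA.
have prodE : \prod_i A i i = a * \prod_i D i i.
  rewrite AE (@big_split_ord _ _ _ 1 n) big_ord1.
  rewrite (@block_mxEul _ 1 n 1 n) mxE mulr1n /=; congr (_ * _).
  by apply: eq_bigr => i _; rewrite (@block_mxEdr _ 1 n 1 n).
have a_ge0 : 0 <= a.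
  have := psd_diag_ge0 (lshift n (0 : 'I_1)) pA.
  by rewrite AE block_mxEul mxE eqxx mulr1n.
have [a0|a0] := eqVneq a 0.
  have b0 : b = 0 by apply: (@psd_block0 _ _ D); rewrite -a0 -AE.
  rewrite prodE AE a0 b0 mul0r trmx0 (@det_ublock _ 1 n) det_scalar1 mul0r.
  by rewrite lexx.
have {}a0 : 0 < a by rewrite lt_neqAle eq_sym a0.
have pS : psd (schur a b D) by apply: psd_schur => //; rewrite -AE.
rewrite prodE AE det_schur ?gt_eqF// pmulr_rge0// ler_pM2l//.
have /andP[-> /le_trans->//] := IHn _ pS.
(* The diagonal of the Schur complement is [D i i - b_i^2 / a]. *)
apply: ler_prod => i _; rewrite psd_diag_ge0//= !mxE lerBlDr lerDl.
rewrite mulr_ge0 ?invr_ge0// sumr_ge0// => k _.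
by rewrite !mxE -expr2 sqr_ge0.
Qed.

Lemma psd_tr_AGM n (A : 'M[R]_n) : psd A ->
  0 <= \tr A /\ \det A <= (\tr A / n%:R) ^+ n.
Proof.
move=> pA; split; first by apply: sumr_ge0 => i _; exact: psd_diag_ge0.
have /andP[_ /le_trans->//] := psd_det_le_prod pA.
have := @leif_AGM R 'I_n predT (fun i => A i i).
rewrite card_ord => /(_ (fun i _ => psd_diag_ge0 i pA)).
by case=> /le_trans + _; apply.
Qed.

Lemma psd_mul_tr_AGM n (A B : 'M[R]_n) : psd A -> psd B ->
  0 <= \tr (A *m B) /\ \det A * \det B <= (\tr (A *m B) / n%:R) ^+ n.
Proof.
move=> /cholesky[L ->] pB.
have pC : psd (L^T *m B *m L) by rewrite -{2}[L]trmxK; exact: psd_congr.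
have -> : \tr (L *m L^T *m B) = \tr (L^T *m B *m L).
  by rewrite -mulmxA mxtrace_mulC.
have -> : \det (L *m L^T) * \det B = \det (L^T *m B *m L).
  by rewrite !det_mulmx; ring.
exact: psd_tr_AGM.
Qed.

(** In the application [A] is the Hessian, [B] the density and [c] the value of [f]; the constraint
    on the Hessian determinant enters through monotonicity of the n-th root. *)
Lemma psd_mul_tr_ge_powR n (A B : 'M[R]_n) (c : R) : (0 < n)%N ->
  psd A -> psd B -> 0 <= c <= \det A ->
  n%:R * (c `^ n%:R^-1 * \det B `^ n%:R^-1) <= \tr (A *m B).
Proof.
move=> n0 pA pB /andP[c0 cA].
have [t0 tAB] := psd_mul_tr_AGM pA pB.
have nR0 : 0 < n%:R :> R by rewrite ltr0n.
have /andP[B0 _] := psd_det_le_prod pB.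
rewrite -powRM// mulrC -ler_pdivlMr//.
have tn0 : 0 <= \tr (A *m B) / n%:R by rewrite divr_ge0// ltW.
have -> : \tr (A *m B) / n%:R = ((\tr (A *m B) / n%:R) `^ n%:R) `^ n%:R^-1.
  by rewrite -powRrM mulfV ?powRr1// gt_eqF.
apply: ge0_ler_powR; rewrite ?nnegrE ?invr_ge0 ?powR_ge0 ?mulr_ge0//.
by rewrite powR_mulrn//; apply: le_trans tAB; rewrite ler_wpM2r.
Qed.

End psd_matrices.

(** * Directional derivatives *)

Section directional_derivatives.
Context {R : realType} {V : normedModType R}.
Implicit Types (Omega : set V) (f g df dg : V -> R) (a b v y : V).

(** Continuous differentiability one direction at a time, which avoids Frechet derivatives.
    Continuity of [df] in all variables, not only along [v], is what makes derivatives additive in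
    the direction. *)
Definition dirC1 Omega f v df := forall y, Omega y ->
  is_derive y v f (df y) /\ {for y, continuous df}.

Lemma is_derive_line f y v (s df : R) :
  is_derive (y + s *: v) v f df <->
  is_derive s 1 (fun t : R => f (y + t *: v)) df.
Proof.
have E : (fun h : R => h^-1 *: (((fun t : R => f (y + t *: v)) \o shift s) (h *: 1) -
      f (y + s *: v))) =
    (fun h : R => h^-1 *: ((f \o shift (y + s *: v)) (h *: v) - f (y + s *: v))).
  apply/funext => h /=; congr (_ *: (f _ - _)).
  by rewrite [h *: 1]mulr1 scalerDl addrCA.
by split=> -[dv <-]; split; move: dv; rewrite /derivable /derive E.
Qed.

Lemma is_derive_translate f y w v (df : R) :
  is_derive (y + w) v f df -> is_derive y v (fun z => f (z + w)) df.
Proof.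
have E : (fun h : R => h^-1 *: (((fun z => f (z + w)) \o shift y) (h *: v) -
      f (y + w))) =
    (fun h : R => h^-1 *: ((f \o shift (y + w)) (h *: v) - f (y + w))).
  by apply/funext => h /=; rewrite addrA.
by case=> dv <-; split; rewrite /derivable /derive E.
Qed.

Lemma near_parallelogram y a b (P : set V) : nbhs y P ->
  exists2 r : R, 0 < r &
    forall s t : R, `|s| <= r -> `|t| <= r -> P (y + s *: a + t *: b).
Proof.
move=> /nbhs_ballP[e /= e0 eP].
(* The [+ 1] keeps [M] positive when both directions vanish and makes the final estimate strict. *)
pose M := `|a| + `|b| + 1.
have M0 : 0 < M by rewrite ltr_wpDl// addr_ge0.
exists (e / M); first by rewrite divr_gt0.
move=> s t sr tr; apply: eP; rewrite -ball_normE /ball_/=.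
rewrite -addrA opprD addNKr normrN.
apply: (le_lt_trans (ler_normD _ _)); rewrite !normrZ.
apply: (@le_lt_trans _ _ (e / M * (`|a| + `|b|))).
  by rewrite mulrDr lerD// ler_wpM2r.
by rewrite -mulrA gtr_pMr// mulrC ltr_pdivrMr// mul1r ltrDl.
Qed.

(** Both signs of [h] are allowed because the difference quotients in [dirC1D] are two-sided
    limits. *)
Lemma mean_value_dir f df y v (h : R) :
  (forall t, `|t| <= `|h| -> is_derive (y + t *: v) v f (df (y + t *: v))) ->
  exists2 c, `|c| <= `|h| & f (y + h *: v) - f y = h * df (y + c *: v).
Proof.
move=> fv; have fl (t : R) (th : `|t| <= `|h|) := (is_derive_line f y v t _).1 (fv t th).
have y0 : y = y + 0 *: v by rewrite scale0r addr0.
have [h0|h0] := leP 0 h.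
  have hin t : t \in `[0, h] -> `|t| <= `|h|.
    by rewrite in_itv/= => /andP[t0 th]; rewrite !ger0_norm.
  have [||c ch fE] := @MVT_segment R (fun t => f (y + t *: v))
      (fun t => df (y + t *: v)) 0 h h0.
  - by move=> t /subset_itv_oo_cc/hin/fl.
  - by apply: derivable_within_continuous => t /hin/fl[].
  by exists c; [exact: hin|rewrite {2}y0 fE subr0 mulrC].
have hin t : t \in `[h, 0] -> `|t| <= `|h|.
  by rewrite in_itv/= => /andP[ht t0]; rewrite !ler0_norm ?lerN2// ltW.
have [||c ch fE] := @MVT_segment R (fun t => f (y + t *: v))
    (fun t => df (y + t *: v)) h 0 (ltW h0).
- by move=> t /subset_itv_oo_cc/hin/fl.
- by apply: derivable_within_continuous => t /hin/fl[].
by exists c; [exact: hin|rewrite {2}y0 -opprB fE sub0r mulrN opprK mulrC].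
Qed.

Lemma dirC1_near Omega f v df y e : open Omega -> dirC1 Omega f v df -> Omega y ->
  0 < e -> \forall z \near y, Omega z /\ `|df z - df y| < e.
Proof.
move=> oO fv Oy e0; apply: filterI; first exact: open_nbhs_nbhs.
have [_ /cvgrPdist_lt/(_ _ e0)] := fv _ Oy.
by apply: filterS => z; rewrite distrC.
Qed.

(** The increment along [h (a + b)] is split into a leg along [h a] followed by a leg along [h b].
    The mean value theorem on each leg gives derivatives at points near [y], and their continuity at
    [y] gives the limit. *)
Lemma dirC1D Omega f a b df dg : open Omega -> dirC1 Omega f a df ->
  dirC1 Omega f b dg -> dirC1 Omega f (a + b) (df \+ dg).
Proof.
move=> oO fa fb y Oy; split; last by apply: cvgD; [case: (fa _ Oy)|case: (fb _ Oy)].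
suff fab : (fun h : R => h^-1 *: ((f \o shift y) (h *: (a + b)) - f y)) @ 0^' -->
    df y + dg y by split; [exact: cvgP fab|exact: cvg_lim fab].
apply/cvgrPdist_lt => e e0.
have e20 : 0 < e / 2 by rewrite divr_gt0.
have [r r0 rP] := near_parallelogram a b (filterI (dirC1_near oO fa Oy e20)
  (dirC1_near oO fb Oy e20)).
near=> h.
have h0 : h != 0 by near: h; exact: nbhs_dnbhs_neq.
have hr : `|h| <= r.
  by near: h; apply: dnbhs0_le.
have r00 : `|0 : R| <= r by rewrite normr0 ltW.
have [|c ch cE] := @mean_value_dir f df y a h.
  move=> t th; have [[Ot _] _] := rP t 0 (le_trans th hr) r00.
  by rewrite scale0r addr0 in Ot; have [] := fa _ Ot.
have [|c' ch' cE'] := @mean_value_dir f dg (y + h *: a) b h.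
  by move=> t th; have [[Ot _] _] := rP h t hr (le_trans th hr); have [] := fb _ Ot.
have -> : (f \o shift y) (h *: (a + b)) - f y =
    h * (df (y + c *: a) + dg (y + h *: a + c' *: b)).
  rewrite mulrDr -cE -cE' [RHS]addrC addrA subrK.
  by congr (f _ - _); rewrite /= scalerDr [LHS]addrC addrA.
rewrite [h^-1 *: _]mulKf// distrC opprD addrACA (splitr e).
apply: (le_lt_trans (ler_normD _ _)); apply: ltrD.
  by have [[]] := rP c 0 (le_trans ch hr) r00; rewrite scale0r addr0.
by have [_ []] := rP h c' hr (le_trans ch' hr).
Unshelve. all: by end_near. Qed.

Lemma dirC1Z Omega f v df (c : R) : dirC1 Omega f v df ->
  dirC1 Omega f (c *: v) (fun y => c * df y).
Proof.
move=> fv y Oy; have [fy cy] := fv _ Oy; split; last exact: cvgMr.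
have y0 w : y + (0 : R) *: w = y by rewrite scale0r addr0.
rewrite -(y0 (c *: v)); apply/is_derive_line.
have -> : (fun t : R => f (y + t *: (c *: v))) =
    (fun t : R => f (y + t *: v)) \o (fun t => c * t).
  by apply/funext => t /=; rewrite scalerA mulrC.
rewrite y0 mulrC; apply: is_derive1_comp.
  by rewrite mulr0; apply/is_derive_line; rewrite y0.
by apply: is_derive_eq; rewrite [LHS]mulr1.
Qed.

Lemma dirC10 Omega f : dirC1 Omega f 0 (fun=> 0).
Proof.
move=> y _; split; last exact: cvg_cst.
by split; [exact: derivable0|rewrite derive0].
Qed.

Lemma dirC1_cst Omega v (c : R) : dirC1 Omega (fun=> c) v (fun=> 0).
Proof. by move=> y _; split; [exact: is_derive_cst|exact: cvg_cst]. Qed.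

Lemma dirC1_addf Omega f g v df dg : dirC1 Omega f v df -> dirC1 Omega g v dg ->
  dirC1 Omega (f \+ g) v (df \+ dg).
Proof.
move=> fv gv y Oy; have [fy cf] := fv _ Oy; have [gy cg] := gv _ Oy.
by split; [exact: is_deriveD|exact: cvgD].
Qed.

Lemma dirC1_scalef Omega f v df (c : R) : dirC1 Omega f v df ->
  dirC1 Omega (fun y => c * f y) v (fun y => c * df y).
Proof.
move=> fv y Oy; have [fy cf] := fv _ Oy.
by split; [exact: is_deriveZ|exact: cvgMr].
Qed.

(** The mean value theorem twice: along [a] for the increment [f (z + h b) - f z], then along [b]
    for [fa]. Serves both the symmetry of the Hessian and its positivity under convexity. *)
Lemma second_difference Omega f a b fa fab y (h : R) : 0 <= h ->
  dirC1 Omega f a fa -> dirC1 Omega fa b fab ->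
  (forall s t, `|s| <= h -> `|t| <= h -> Omega (y + s *: a + t *: b)) ->
  exists s t, [/\ `|s| <= h, `|t| <= h &
    f (y + h *: a + h *: b) - f (y + h *: a) - (f (y + h *: b) - f y) =
    h * (h * fab (y + s *: a + t *: b))].
Proof.
move=> h0 fda fdab O; have nh : `|h| = h by rewrite ger0_norm.
pose g z := f (z + h *: b) - f z; pose dg z := fa (z + h *: b) - fa z.
have h00 : `|0 : R| <= h by rewrite normr0.
have [s sh gE] : exists2 s, `|s| <= `|h| &
    g (y + h *: a) - g y = h * dg (y + s *: a).
  apply: mean_value_dir => t; rewrite nh => th.
  have Ot := O t h th; have O0 := O t 0 th h00; rewrite scale0r addr0 in O0.
  apply: is_deriveB; last by have [] := fda _ O0.
  by apply: is_derive_translate; have [] := fda _ (Ot _); rewrite ?nh.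
have [|t th tE] := @mean_value_dir fa fab (y + s *: a) b h.
  rewrite nh in sh; move=> t; rewrite nh => th; by have [] := fdab _ (O s t sh th).
move: sh th; rewrite nh => sh th; exists s, t; split => //.
by rewrite /g /dg in gE; rewrite gE tE.
Qed.

(** Schwarz's theorem. The second difference does not change when [a] and [b] are swapped, so the
    two mixed derivatives share a value at points arbitrarily close to [y]. *)
Lemma mixed_derivativeC Omega f a b fa fb fab fba y : open Omega -> Omega y ->
  dirC1 Omega f a fa -> dirC1 Omega fa b fab ->
  dirC1 Omega f b fb -> dirC1 Omega fb a fba -> fab y = fba y.
Proof.
move=> oO Oy fda fdab fdb fdba.
apply/eqP; rewrite -subr_eq0 -normr_le0; apply/ler_addgt0Pl => e e0; rewrite addr0.
have e20 : 0 < e / 2 by rewrite divr_gt0.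
have [r r0 rP] := near_parallelogram a b (filterI (dirC1_near oO fdab Oy e20)
  (dirC1_near oO fdba Oy e20)).
have [|s [t [sr tr E]]] := second_difference (ltW r0) fda fdab (y := y).
  by move=> s t sr tr; have [[]] := rP s t sr tr.
have [|t' [s' [tr' sr' E']]] := second_difference (ltW r0) fdb fdba (y := y).
  by move=> t' s' tr' sr'; have [[]] := rP s' t' sr' tr'; rewrite addrAC.
have E2 : fab (y + s *: a + t *: b) = fba (y + t' *: b + s' *: a).
  apply: (mulfI (lt0r_neq0 r0)); apply: (mulfI (lt0r_neq0 r0)).
  rewrite -E -E' [y + r *: b + _]addrAC; ring.
have [[_ H1] _] := rP s t sr tr.
have [_ [_ H2]] := rP s' t' sr' tr'; rewrite addrAC in H2.
have -> : fab y - fba y = (fba (y + t' *: b + s' *: a) - fba y) -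
  (fab (y + s *: a + t *: b) - fab y) by rewrite E2; ring.
by rewrite (splitr e) (le_trans (ler_normB _ _))// lerD// ltW.
Qed.

End directional_derivatives.

(** * Gradient and Hessian of functions that are C^2 up to the boundary *)

Section directional_derivatives_rV.
Context {R : realType} {n : nat}.
Implicit Types (Omega : set 'rV[R]_n) (f u : 'rV[R]_n -> R) (v w : 'rV[R]_n).

Lemma dirC1_ext Omega f f' (df df' : 'rV[R]_n -> R) v : f =1 f' -> df =1 df' ->
  dirC1 Omega f v df -> dirC1 Omega f' v df'.
Proof. by move=> /funext-> /funext->. Qed.

Lemma dirC1_sumf {I : Type} (s : seq I) Omega (c : I -> R)
    (F dF : I -> 'rV[R]_n -> R) v :
  (forall i, dirC1 Omega (F i) v (dF i)) ->
  dirC1 Omega (fun y => \sum_(i <- s) c i * F i y) v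
    (fun y => \sum_(i <- s) c i * dF i y).
Proof.
move=> FdF; elim: s => [|i s IHs].
  by apply: dirC1_ext (dirC1_cst (Omega := Omega) v 0) => y; rewrite big_nil.
apply: (dirC1_ext (f := (fun y => c i * F i y) \+ (fun y => \sum_(j <- s) c j * F j y))
  (df := (fun y => c i * dF i y) \+ (fun y => \sum_(j <- s) c j * dF j y))).
- by move=> y; rewrite big_cons.
- by move=> y; rewrite big_cons.
by apply: dirC1_addf => //; exact: dirC1_scalef.
Qed.

Lemma dirC1_rV Omega f (df : 'I_n -> 'rV[R]_n -> R) v : open Omega ->
  (forall i, dirC1 Omega f (delta_mx 0 i) (df i)) ->
  dirC1 Omega f v (fun y => \sum_i v 0 i * df i y).
Proof.
move=> oO fdf; rewrite {1}[v]row_sum_delta.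
elim: (index_enum _) => [|i s IHs].
  by rewrite big_nil; apply: dirC1_ext (dirC10 f) => // y; rewrite big_nil.
rewrite big_cons; apply: (dirC1_ext (f := f)
  (df := (fun y => v 0 i * df i y) \+ (fun y => \sum_(j <- s) v 0 j * df j y))) => //.
  by move=> y; rewrite big_cons.
by apply: dirC1D => //; exact: dirC1Z.
Qed.

(** The order of sums and indices is the one produced by differentiating along [v] first and then
    along [w], since [hessian u y j i] is [partial j (partial i u) y]. *)
Definition quad (A : 'M[R]_n) (v w : 'rV[R]_n) : R :=
  \sum_i v 0 i * \sum_j w 0 j * A j i.

Lemma quadE (A : 'M[R]_n) (v : 'rV[R]_n) : quad A v v = (v *m A *m v^T) 0 0.
Proof.
rewrite mxE; apply: eq_bigr => j _; rewrite !mxE mulrC; congr (_ * _).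
Qed.

Lemma extends_to_closure_continuous Omega (g : 'rV[R]_n -> R) y : open Omega ->
  extends_to_closure Omega g -> Omega y -> {for y, continuous g}.
Proof.
move=> oO [h ch gh] Oy.
have hO : {in Omega, continuous h}.
  rewrite -continuous_open_subspace//.
  exact: (continuous_subspaceW (@subset_closure _ _)).
have hg : {near y, h =1 g}.
  have : \forall z \near y, Omega z by exact: open_nbhs_nbhs.
  by apply: filterS => z Oz; rewrite gh// inE.
rewrite /continuous_at/prop_for/= gh ?inE//.
by have := hO y; rewrite inE => /(_ Oy); apply: cvg_trans; exact: near_eq_cvg hg.
Qed.

Section C2.
Variables (Omega : set 'rV[R]_n) (u : 'rV[R]_n -> R).
Hypotheses (oO : open Omega) (uC2 : C2_closure Omega u).

Lemma C2_dirC1 v : dirC1 Omega u v (fun y => \sum_i v 0 i * partial i u y).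
Proof.
apply: dirC1_rV => // i y Oy; have [_ /(_ i)[du eu] _] := uC2; split.
  by apply: DeriveDef => //; apply: du; rewrite inE.
exact: (extends_to_closure_continuous oO).
Qed.

Lemma C2_dirC1_partial i j :
  dirC1 Omega (partial j u) (delta_mx 0 i) (partial i (partial j u)).
Proof.
move=> y Oy; have [_ _ /(_ i j)[du eu]] := uC2; split.
  by apply: DeriveDef => //; apply: du; rewrite inE.
exact: (extends_to_closure_continuous oO).
Qed.

Lemma C2_dirC2 v w :
  dirC1 Omega (fun y => \sum_i v 0 i * partial i u y) w
    (fun y => quad (hessian u y) v w).
Proof.
apply: dirC1_sumf => i.
rewrite [X in dirC1 _ _ _ X](_ : _ =
    fun y => \sum_j w 0 j * partial j (partial i u) y).
  by apply: dirC1_rV => // j; exact: C2_dirC1_partial.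
by apply/funext => y; apply: eq_bigr => j _; rewrite mxE.
Qed.

Lemma hessian_sym y : Omega y -> (hessian u y)^T = hessian u y.
Proof.
move=> Oy; apply/matrixP => i j; rewrite !mxE.
have dE k : dirC1 Omega u (delta_mx 0 k) (partial k u).
  have := C2_dirC1 (delta_mx 0 k); congr dirC1; apply/funext => z.
  rewrite (bigD1 k)//= big1 => [|l /negPf lk]; first by rewrite !mxE !eqxx mul1r addr0.
  by rewrite mxE lk mul0r.
by apply: (mixed_derivativeC oO Oy (dE i) _ (dE j)); exact: C2_dirC1_partial.
Qed.

(** A negative second derivative along [v] would persist near [y]; the second difference in the
    directions [v] and [- v] is then [2 u(y) - u(y + r v) - u(y - r v) > 0], against midpoint
    convexity. *)
Lemma convex_hessian_psd y : convex_function (closure Omega) u ->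
  Omega y -> psd (hessian u y).
Proof.
move=> cu Oy; split=> [|v]; first exact: hessian_sym.
rewrite -quadE leNgt; apply/negP => q0.
have Nv : quad (hessian u y) v v = - quad (hessian u y) v (- v).
  rewrite /quad -sumrN; apply: eq_bigr => i _; rewrite -mulrN; congr (_ * _).
  by rewrite -sumrN; apply: eq_bigr => j _; rewrite [(- v) 0 j]mxE mulNr opprK.
have d2 := C2_dirC2 v (- v).
have q0' : 0 < quad (hessian u y) v (- v) by rewrite -oppr_lt0 -Nv.
have [r r0 rP] := near_parallelogram v (- v) (dirC1_near oO d2 Oy q0').
have [|s [t [sr tr]]] := second_difference (ltW r0) (C2_dirC1 v) d2 (y := y).
  by move=> s t sr tr; have [] := rP s t sr tr.
set q := quad (hessian u _) _ _.
have pos (a b : R) : `|a - b| < b -> 0 < a by rewrite ltr_distl subrr => /andP[].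
have q_gt0 : 0 < q := pos _ _ (rP s t sr tr).2.
have r0' : `|0 : R| <= r by rewrite normr0 ltW.
have rr : `|r| <= r by rewrite gtr0_norm.
have Op : Omega (y + r *: v) by have [] := rP r 0 rr r0'; rewrite scale0r addr0.
have Om : Omega (y + r *: (- v)) by have [] := rP 0 r r0' rr; rewrite scale0r addr0.
rewrite scalerN addrK => E.
have : 0 < u y - u (y + r *: v) - (u (y + r *: - v) - u y).
  by rewrite scalerN E !mulr_gt0.
apply/negP; rewrite -leNgt.
have h01 : (0 : R) <= 2^-1 by rewrite invr_ge0.
have h11 : 2^-1 <= (1 : R) by rewrite invf_le1// ler1n.
have mid (a b : 'rV[R]_n) : 2^-1 *: (a + b) + 2^-1 *: (a - b) = a.
  rewrite -scalerDr addrACA subrr addr0 -mulr2n -[a *+ 2]scaler_nat scalerA mulVf ?scale1r//.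
have := cu (Itv01 h01 h11) _ _ (mem_set (subset_closure Op)) (mem_set (subset_closure Om)).
rewrite [X in _ <= X]convRE /conv/= /unstable.onem.
have -> : 2^-1 *: (y + r *: v) + (1 - 2^-1) *: (y + r *: - v) = y.
  have -> : 1 - 2^-1 = 2^-1 :> R by lra.
  rewrite scalerN; apply: mid.
by lra.
Qed.

End C2.

End directional_derivatives_rV.

(** * Taylor's formula in a convex domain *)

Lemma continuous_sumr {R : realType} {T : topologicalType} (I : Type) (s : seq I)
    (f : I -> T -> R) :
  (forall i, continuous (f i)) -> continuous (fun t => \sum_(i <- s) f i t).
Proof.
move=> cf; elim: s => [|i s IHs].
  by under eq_fun do rewrite big_nil; exact: cst_continuous.
under eq_fun do rewrite big_cons.
by move=> t; apply: cvgD; [exact: cf|exact: IHs].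
Qed.

Section convex_domain.
Context {R : realType} {n : nat}.
Implicit Types (Omega : set 'rV[R]_n) (x y : 'rV[R]_n).

Lemma bounded_closure Omega : bounded_set Omega -> bounded_set (closure Omega).
Proof.
move=> [M [Mr MO]]; exists M; split=> // K MK y cy.
have cl : closed [set z : 'rV[R]_n | `|z| <= K].
  apply: (@closed_comp _ _ (fun z : 'rV[R]_n => `|z|) [set r : R | r <= K]).
    by move=> z _; exact: norm_continuous.
  exact: closed_le.
have := closureS (MO K MK) cy; rewrite -(closure_id _).1//; exact.
Qed.

(** Tietze's theorem on the closed set [closure Omega], where compactness provides the bound. *)
Lemma closure_continuous_extension Omega (h : 'rV[R]_n -> R) :
  bounded_set Omega -> {within closure Omega, continuous h} ->
  exists2 g : 'rV[R]_n -> R, continuous g &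
    (exists M : R, forall y, `|g y| <= M) /\ {in closure Omega, h =1 g}.
Proof.
move=> bO ch.
have cO : compact (closure Omega).
  by apply: bounded_closed_compact; [exact: bounded_closure|exact: closed_closure].
have [M [Mr MO]] := compact_bounded (continuous_compact ch cO).
pose K := Num.max M 0 + 1.
have K0 : 0 < K by rewrite ltr_pwDr// le_max lexx orbT.
have hK y : closure Omega y -> `|h y| <= K.
  move=> cy; apply: MO; last by exists y.
  by rewrite ltr_pwDr// le_max lexx.
have [g [gh cg gK]] := continuous_bounded_extension (@pseudometric_normal R _)
  (@closed_closure _ Omega) K0 ch hK.
by exists g => //; split => //; exists K.
Qed.

(** Since [y] is only in the closure, it is replaced by a nearby [y'] in [Omega], and the error is
    absorbed by moving [x] inside a ball contained in [Omega]. *)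
Lemma convex_segment Omega x y (t : R) : open Omega -> convex_set Omega ->
  Omega x -> closure Omega y -> 0 <= t -> t < 1 -> Omega (x + t *: (y - x)).
Proof.
move=> oO cO Ox cy t0 t1.
have /nbhs_ballP[e /= e0 xe] : nbhs x Omega by exact: open_nbhs_nbhs.
have s0 : 0 < 1 - t by rewrite subr_gt0.
have [y' [Oy' yy']] : Omega `&` ball y (e * (1 - t)) !=set0.
  by apply: cy; apply: nbhsx_ballx; rewrite mulr_gt0.
(* Determined by [(1 - t) x' + t y' = x + t (y - x)]; the radius [e (1 - t)] chosen for [y']
   compensates the denominator. *)
pose x' := x + (t / (1 - t)) *: (y - y').
have Ox' : Omega x'.
  apply: xe; rewrite -ball_normE /ball_/= opprD addNKr normrN normrZ.
  have := yy'; rewrite -ball_normE /ball_/= => yy''.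
  have ts : 0 <= t / (1 - t) by rewrite divr_ge0// ltW.
  rewrite [`|t / _|]ger0_norm// mulrAC ltr_pdivrMr//.
  by apply: le_lt_trans yy''; rewrite ler_piMl// ltW.
have := cO x' y' (Itv01 (ltW s0) (ltac:(by rewrite gerBl)))
  (mem_set Ox') (mem_set Oy').
rewrite inE /conv/= /unstable.onem; congr Omega.
rewrite scalerDr scalerA mulrC divfK ?gt_eqF//.
have -> : 1 - (1 - t) = t by ring.
rewrite -addrA -scalerDr subrK scalerBl scale1r -addrA; congr (_ + _).
by rewrite scalerBr addrC.
Qed.

End convex_domain.

Section taylor.
Context {R : realType} {n : nat}.
Variables (Omega : set 'rV[R]_n) (u : 'rV[R]_n -> R).
Hypotheses (dO : bounded_convex_domain Omega) (uC2 : C2_closure Omega u).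

Let oO : open Omega. Proof. by case: dO. Qed.
Let bO : bounded_set Omega. Proof. by case: dO. Qed.
Let cO : convex_set Omega. Proof. by case: dO. Qed.

Lemma extends_to_closure_extension (g : 'rV[R]_n -> R) :
  extends_to_closure Omega g ->
  exists2 h : 'rV[R]_n -> R, continuous h &
    (exists M : R, forall y, `|h y| <= M) /\ {in Omega, g =1 h}.
Proof.
move=> [h /(closure_continuous_extension bO)[k ck [Mk hk]] gh].
exists k => //; split => // y /[dup] Oy; rewrite inE => /subset_closure cy.
by rewrite gh// hk// inE.
Qed.

Lemma hessian_extension : exists2 H : 'rV[R]_n -> 'M[R]_n,
  (forall i j, continuous (fun y => H y i j) /\ exists M : R, forall y, `|H y i j| <= M) &
  forall y, Omega y -> hessian u y = H y.
Proof.
have [_ _ uC] := uC2.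
have /choice[h hP] : forall ij : 'I_n * 'I_n, exists h : 'rV[R]_n -> R,
    [/\ continuous h, exists M : R, forall y, `|h y| <= M &
      {in Omega, partial ij.1 (partial ij.2 u) =1 h}].
  move=> [i j]; have [_ /extends_to_closure_extension[h ch [Mh hE]]] := uC i j.
  by exists h.
exists (fun y => \matrix_(i, j) h (i, j) y) => [i j|y Oy].
  under eq_fun do rewrite mxE.
  have [ch [M Mh] _] := hP (i, j); split => //.
  by exists M => y; rewrite mxE.
apply/matrixP => i j; rewrite !mxE; have [_ _ ->//] := hP (i, j).
by rewrite inE.
Qed.

Lemma gradient_extension : exists2 D : 'I_n -> 'rV[R]_n -> R,
  (forall i, continuous (D i)) & forall i y, Omega y -> partial i u y = D i y.
Proof.
have [_ uC _] := uC2.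
have /choice[h hP] : forall i : 'I_n, exists h : 'rV[R]_n -> R,
    continuous h /\ {in Omega, partial i u =1 h}.
  move=> i; have [_ /extends_to_closure_extension[h ch [Mh hE]]] := uC i.
  by exists h.
exists h => [i|i y Oy]; first by have [] := hP i.
by have [_ ->//] := hP i; rewrite inE.
Qed.

(** The endpoint [y] may lie on the boundary, where [u] need not have derivatives; the extensions
    [U], [D], [H] keep primitive and integrand continuous up to [t = 1]. *)
Lemma taylor_segment x y : Omega x -> closure Omega y ->
  (\int[@lebesgue_measure R]_(t in `[0%R, 1%R[)
     ((1 - t) * quad (hessian u (x + t *: (y - x))) (y - x) (y - x))%:E =
   (u y - u x - \sum_i (y - x) 0 i * partial i u x)%:E)%E.
Proof.
move=> Ox cy; set w := y - x.
have [cu _ _] := uC2.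
have [U cU [_ uU]] := closure_continuous_extension bO cu.
have [D cD uD] := gradient_extension.
have [H cH uH] := hessian_extension.
pose p (t : R) := x + t *: w.
have cp : continuous p.
  move=> t; apply: cvgD; first exact: cvg_cst.
  by apply: cvgZl; exact: cvg_id.
have Op (t : R) : 0 <= t -> t < 1 -> Omega (p t) by exact: convex_segment.
(* Integration by parts built into the primitive: in [F'] the two first order terms cancel, leaving
   [(1 - t)] times the second derivative. At [t = 1] only [u y] survives; at [t = 0] the first order
   Taylor polynomial does. *)
pose F t := U (p t) + (1 - t) * \sum_i w 0 i * D i (p t).
pose k t := (1 - t) * quad (H (p t)) w w.
have c1 : continuous (fun t : R => 1 - t).
  by move=> t; apply: cvgB; [exact: cvg_cst|exact: cvg_id].
have cF : continuous F.
  move=> t; apply: cvgD; first by apply: continuous_comp; [exact: cp|exact: cU].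
  apply: cvgM; first exact: c1.
  apply: continuous_sumr => i {}t; apply: cvgM; first exact: cvg_cst.
  by apply: continuous_comp; [exact: cp|exact: cD].
have ck : continuous k.
  move=> t; apply: cvgM; first exact: c1.
  apply: continuous_sumr => i {}t; apply: cvgM; first exact: cvg_cst.
  apply: continuous_sumr => j {}t; apply: cvgM; first exact: cvg_cst.
  apply: (@continuous_comp _ _ _ p (fun z => H z j i)); first exact: cp.
  by have [cHji _] := cH j i; exact: cHji.
have dF (t : R) : t \in `]0, 1[ -> is_derive t 1 F (k t).
  move=> t01; have /andP[t0 t1] : 0 < t < 1 by move: t01; rewrite in_itv.
  have Ot : Omega (p t) by apply: Op => //; exact: ltW.
  pose g (s : R) := \sum_i w 0 i * partial i u (p s).
  have du : is_derive t 1 (fun s => u (p s)) (g t).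
    have [du _] := C2_dirC1 oO uC2 w Ot.
    exact: (is_derive_line u x w t (g t)).1 du.
  have dg : is_derive t 1 g (quad (hessian u (p t)) w w).
    have [dg _] := C2_dirC2 oO uC2 w w Ot.
    exact: (is_derive_line (fun z => \sum_i w 0 i * partial i u z) x w t _).1 dg.
  have d1 : is_derive t 1 (fun s : R => 1 - s) (- 1).
    by rewrite -sub0r; exact: (is_deriveB (is_derive_cst (1 : R) t 1) (is_derive_id t 1)).
  apply: (@near_eq_is_derive _ _ _ (fun s => u (p s) + (1 - s) * g s)).
    have : \forall s \near t, Omega (p s).
      by apply: cp; exact: open_nbhs_nbhs.
    apply: filterS => s Os; rewrite /F uU ?inE; last exact: subset_closure.
    by congr (_ + _ * _); apply: eq_bigr => i _; rewrite uD.
  have -> : k t = g t + ((1 - t) *: quad (hessian u (p t)) w w + g t *: (- 1)).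
    by rewrite /k -uH// /GRing.scale/=; ring.
  exact: is_deriveD du (is_deriveM d1 dg).
transitivity (\int[@lebesgue_measure R]_(t in `[0%R, 1%R[) (k t)%:E)%E.
  apply: eq_integral => t; rewrite inE/= in_itv/= => /andP[t0 t1].
  by rewrite uH//; exact: Op.
rewrite integral_itv_bndo_bndc; last first.
  by apply/measurable_EFinP/measurable_funTS; exact: continuous_measurable_fun.
rewrite (@continuous_FTC2 _ k F)//.
- have F1 : F 1 = u y.
    by rewrite /F /p subrr mul0r addr0 scale1r [x + w]addrC subrK uU// inE.
  have F0 : F 0 = u x + \sum_i w 0 i * partial i u x.
    rewrite /F /p scale0r addr0 subr0 mul1r uU ?inE; last exact: subset_closure.
    by congr (_ + _); apply: eq_bigr => i _; rewrite uD.
  by rewrite -EFinB F1 F0 opprD addrA.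
- exact: continuous_subspaceT.
- split; first by move=> t /dF[].
  + by apply: cvg_at_right_filter; exact: cF.
  + by apply: cvg_at_left_filter; exact: cF.
- by move=> t /dF[_ <-]; rewrite derive1E.
Qed.

End taylor.

(** * Integration against charges *)

Section finite_measure_add.
Context d (T : measurableType d) (R : realType).
Variables m1 m2 : {finite_measure set T -> \bar R}.

Let fin : fin_num_fun (measure_add m1 m2).
Proof. by move=> A mA; rewrite measure_addE fin_numD !fin_num_measure. Qed.

HB.instance Definition _ := Measure.on (measure_add m1 m2).

HB.instance Definition _ := @Measure_isFinite.Build _ _ _ (measure_add m1 m2) fin.

Lemma finite_measure_addP : exists m : {finite_measure set T -> \bar R},
  (forall A, m A = m1 A + m2 A)%E /\
  forall D f, measurable D -> m1.-integrable D f -> m2.-integrable D f ->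
    (\int[m]_(x in D) f x = \int[m1]_(x in D) f x + \int[m2]_(x in D) f x)%E.
Proof.
exists (measure_add m1 m2); split=> [A|D f mD if1 if2]; first exact: measure_addE.
exact: integral_measure_add.
Qed.

End finite_measure_add.

(* Canonical structure inference does not see that the product of two sigma-finite
   measures is sigma-finite; the copy carries an explicit proof instead. *)
Section sigma_finite_copy.
Context d (T : measurableType d) (R : realType) (m : {measure set T -> \bar R}).

Definition sigma_finite_copy of sigma_finite setT m : set T -> \bar R := m.

Hypothesis sf : sigma_finite setT m.

HB.instance Definition _ := Measure.on (sigma_finite_copy sf).

HB.instance Definition _ :=
  Measure_isSigmaFinite.Build _ _ _ (sigma_finite_copy sf) sf.

End sigma_finite_copy.

Lemma fin_num_subeE (R : realType) (a b c e : \bar R) : a \is a fin_num ->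
  b \is a fin_num -> c \is a fin_num -> e \is a fin_num ->
  (a - b = c - e <-> a + e = c + b)%E.
Proof.
move: a b c e => [a| |] [b| |] [c| |] [e| |]// _ _ _ _.
by rewrite -!EFinB -!EFinD; split=> -[abce]; congr EFin; lra.
Qed.

Section charge_integral_theory.
Context d (T : measurableType d) (R : realType).
Local Open Scope ereal_scope.
Implicit Types (nu : {charge set T -> \bar R}) (D : set T) (f : T -> R).

Definition bounded_measurable D f :=
  measurable_fun D f /\ exists M : R, forall x, D x -> (`|f x| <= M)%R.

Lemma bounded_measurable_integrable (m : {finite_measure set T -> \bar R}) D f :
  measurable D -> bounded_measurable D f -> m.-integrable D (EFin \o f).
Proof.
move=> mD [mf [M fM]]; apply: measurable_bounded_integrable => //.
  by rewrite -ge0_fin_numE// fin_num_measure.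
exists M; split=> [|K MK x Dx]; first exact: num_real.
exact: le_trans (fM _ Dx) (ltW MK).
Qed.

(** Hides the chosen Hahn decomposition behind two finite measures. The set [P] is kept because
    densities of the Jordan parts are obtained by restriction to [P] and to its complement. *)
Lemma jordan_measures nu : exists p n : {finite_measure set T -> \bar R},
  [/\ forall A, measurable A -> nu A = p A - n A,
      forall D (f : T -> \bar R), charge_integral nu D f =
        \int[p]_(x in D) f x - \int[n]_(x in D) f x &
      exists2 P, measurable P & forall A, measurable A ->
        p A = nu (A `&` P) /\ n A = - nu (A `\` P)].
Proof.
exists (jordan_pos (hahn_pos_neg nu)), (jordan_neg (hahn_pos_neg nu)); split=> //.
  by move=> A mA; rewrite [LHS](jordan_decomp (hahn_pos_neg nu) mA) /cadd/= cscaleN1.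
have [[mP _] [mN _] PNT PN0] := hahn_pos_neg nu.
exists (hahn_pos nu) => // A mA; split.
  transitivity (crestr0 nu mP A); first exact: jordan_posE.
  by rewrite /crestr0 mem_set.
transitivity (- crestr0 nu mN A); first exact: (cjordan_negE (hahn_pos_neg nu)).
rewrite /crestr0 mem_set// /crestr; congr (- nu _).
rewrite setDE; congr (_ `&` _).
apply/seteqP; split=> [x Nx Px|x nPx].
  by have : (hahn_pos nu `&` hahn_neg nu) x by []; rewrite PN0.
by have : (hahn_pos nu `|` hahn_neg nu) x; [rewrite PNT|case].
Qed.

Lemma charge_dominating_measure (I : eqType) (s : seq I)
    (nu : I -> {charge set T -> \bar R}) :
  exists m : {finite_measure set T -> \bar R}, forall i, i \in s -> nu i `<< m.
Proof.
elim: s => [|i s [m Hm]]; first by exists mzero.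
have [jp [jn [nuE _ _]]] := jordan_measures (nu i).
have [m1 [m1E _]] := finite_measure_addP jn m.
have [m2 [m2E _]] := finite_measure_addP jp m1.
exists m2 => j; rewrite in_cons => js; apply/null_content_dominatesP => A mA.
move=> m0; have {m0} : jp A + (jn A + m A) = 0 by rewrite -m1E -m2E.
move=> /eqP; rewrite padde_eq0 ?adde_ge0// => /andP[/eqP jpA].
rewrite padde_eq0// => /andP[/eqP jnA /eqP mA0].
move: js => /predU1P[->|/Hm/null_content_dominatesP]; last exact.
by rewrite nuE// jpA jnA sube0.
Qed.

(** Independence of the decomposition: equality of the differences means [jp + m2 = m1 + jn] as
    measures, and all integrals of [f] are finite, so the terms can be moved back. *)
Lemma charge_integral_diff nu (m1 m2 : {finite_measure set T -> \bar R}) D f :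
  measurable D -> bounded_measurable D f ->
  (forall A, measurable A -> nu A = m1 A - m2 A) ->
  charge_integral nu D (EFin \o f) =
    \int[m1]_(x in D) (f x)%:E - \int[m2]_(x in D) (f x)%:E.
Proof.
move=> mD bf nuE; have [jp [jn [nuJ -> _]]] := jordan_measures nu.
have jE A : measurable A -> jp A + m2 A = m1 A + jn A.
  by move=> mA; apply/fin_num_subeE; rewrite ?fin_num_measure// -nuJ// nuE.
have ifi (m : {finite_measure set T -> \bar R}) : m.-integrable D (EFin \o f).
  exact: bounded_measurable_integrable.
have iE : \int[jp]_(x in D) (f x)%:E + \int[m2]_(x in D) (f x)%:E =
    \int[m1]_(x in D) (f x)%:E + \int[jn]_(x in D) (f x)%:E.
  have [a [aE ai]] := finite_measure_addP jp m2.
  have [b [bE bi]] := finite_measure_addP m1 jn.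
  rewrite -ai -?bi//; try exact: ifi.
  by apply: eq_measure_integral => A mA _; rewrite [LHS]aE [RHS]bE jE.
have fi (m : {finite_measure set T -> \bar R}) : \int[m]_(x in D) (f x)%:E \is a fin_num.
  exact: (integrable_fin_num mD (ifi _)).
by apply/fin_num_subeE; first [exact: fi|exact: iE].
Qed.

Lemma charge_integral_add nu nu1 nu2 D f : measurable D -> bounded_measurable D f ->
  (forall A, measurable A -> nu A = nu1 A + nu2 A) ->
  charge_integral nu D (EFin \o f) =
    charge_integral nu1 D (EFin \o f) + charge_integral nu2 D (EFin \o f).
Proof.
move=> mD bf nuE.
have [p1 [n1 [nu1E -> _]]] := jordan_measures nu1.
have [p2 [n2 [nu2E -> _]]] := jordan_measures nu2.
have ifi (m : {finite_measure set T -> \bar R}) : m.-integrable D (EFin \o f).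
  exact: bounded_measurable_integrable.
have [p [pE pi]] := finite_measure_addP p1 p2.
have [m [mE mi]] := finite_measure_addP n1 n2.
rewrite (@charge_integral_diff nu p m)//.
  rewrite pi ?mi//; try exact: ifi.
  have fi (j : {finite_measure set T -> \bar R}) : \int[j]_(x in D) (f x)%:E \is a fin_num.
    exact: (integrable_fin_num mD (ifi _)).
  by rewrite oppeD ?fin_num_adde_defl// addeACA.
move=> A mA; rewrite nuE// pE mE nu1E// nu2E//.
by rewrite oppeD ?fin_num_adde_defl ?fin_num_measure// addeACA.
Qed.

(** The Jordan parts have densities [g] on [P] and [- g] off [P]; subtracting their integrals
    restores [g]. Sigma-finiteness is the right generality, since [m] will be Lebesgue measure or a
    product with it. *)
Lemma charge_integral_density_sigma_finite nu (m : {sigma_finite_measure set T -> \bar R})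
    (g : T -> R) D f : measurable D -> bounded_measurable D f ->
  m.-integrable setT (EFin \o g) ->
  (forall A, measurable A -> nu A = \int[m]_(x in A) (g x)%:E) ->
  charge_integral nu D (EFin \o f) = \int[m]_(x in D) (f x * g x)%:E /\
  m.-integrable D (fun x => (f x * g x)%:E).
Proof.
move=> mD bf ig nuE; have [mf [M fM]] := bf.
have mg : measurable_fun setT g by apply/measurable_EFinP; exact: measurable_int ig.
have num : nu `<< m.
  apply/null_content_dominatesP => A mA mA0; rewrite nuE//.
  by apply: null_set_integral => //; exact/measurable_EFinP/measurable_funTS.
have mbg (S : set T) (e : R) : measurable S ->
    m.-integrable setT (fun x => (e * (g \_ S) x)%:E).
  move=> mS; have h : m.-integrable setT (EFin \o (g \_ S)).
    by rewrite -restrict_EFin; apply/(integrable_mkcond _ mS); exact: integrableS ig.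
  exact: (integrableZl measurableT e h).
have mbfg (h : T -> R) : m.-integrable setT (EFin \o h) ->
    m.-integrable D (fun x => (f x * h x)%:E).
  move=> ih; apply: (integrableMr mD mf _ (integrableS measurableT mD _ ih)) => //.
  by exists M; split=> [|K MK x Dx]; [exact: num_real|exact: le_trans (fM _ Dx) (ltW MK)].
(* One statement for both parts: [S = P] with sign [e = 1], and [S] the complement of [P] with
   [e = -1]. *)
have RN (S : set T) (j : {finite_measure set T -> \bar R}) (e : R) : measurable S ->
    (forall A, measurable A -> j A = e%:E * nu (A `&` S)) ->
    \int[j]_(x in D) (f x)%:E = \int[m]_(x in D) (f x * (e * (g \_ S) x))%:E.
  move=> mS jE.
  have jm : j `<< m.
    apply/null_content_dominatesP => A mA mA0; have -> : j A = e%:E * nu (A `&` S) by exact: jE.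
    move/null_content_dominatesP : num => ->; rewrite ?mule0//; first exact: measurableI.
    by apply: subset_measure0 mA0 => //; exact: measurableI.
  rewrite -(Radon_Nikodym_change_of_variables jm mD) //; last first.
    exact: bounded_measurable_integrable.
  have fE : measurable_fun D (EFin \o f) by exact/measurable_EFinP.
  apply: ae_eq_integral => //.
  - by apply: emeasurable_funM => //; apply: measurable_funTS.
  - exact: (measurable_int m (mbfg (fun x => e * (g \_ S) x)%R (mbg S e mS))).
  - suff : ae_eq m D (Radon_Nikodym (charge_of_finite_measure j) m)
        (fun x => (e * (g \_ S) x)%:E) by move/(ae_eqe_mul2l (EFin \o f)).
    apply: integral_ae_eq => //.
    + by apply: (integrableS measurableT mD _ _) => //; exact: Radon_Nikodym_integrable.
    + by apply: measurable_funTS; exact: (measurable_int m (mbg S e mS)).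
    move=> E ED mE; rewrite -Radon_Nikodym_integral//.
    transitivity (e%:E * nu (E `&` S)); first exact: jE.
    rewrite nuE; last exact: measurableI.
    rewrite integral_mkcondr -integralZl//; last first.
      rewrite restrict_EFin; have := mbg S 1%R mS.
      by under eq_fun do rewrite mul1r; exact: integrableS.
    by apply: eq_integral => x _; rewrite restrict_EFin EFinM.
have [p [n [_ -> [P mP pnE]]]] := jordan_measures nu.
have igf := mbfg _ ig; split => //.
rewrite (RN P p 1%R)//; last first.
  by move=> A mA; rewrite mul1e; have [] := pnE A mA.
rewrite (RN (~` P) n (-1)%R)//; [|exact: measurableC|]; last first.
  by move=> A mA; rewrite EFinN mulN1e -setDE; have [] := pnE A mA.
have ifp := mbfg _ (mbg P 1%R mP).
have ifn := mbfg _ (mbg (~` P) (-1)%R (measurableC mP)).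
rewrite -integralB//; apply: eq_integral => x _; rewrite -EFinB; congr EFin.
rewrite -mulrBr; congr (_ * _)%R; rewrite mul1r mulN1r opprK /patch in_setC.
by case: ifPn => _ /=; rewrite ?addr0 ?add0r.
Qed.

Lemma charge_integral_density nu (m : {measure set T -> \bar R})
    (g : T -> R) D f : sigma_finite setT m -> measurable D -> bounded_measurable D f ->
  m.-integrable setT (EFin \o g) ->
  (forall A, measurable A -> nu A = \int[m]_(x in A) (g x)%:E) ->
  charge_integral nu D (EFin \o f) = \int[m]_(x in D) (f x * g x)%:E /\
  m.-integrable D (fun x => (f x * g x)%:E).
Proof.
move=> sf mD bf ig nuE.
pose m' : {sigma_finite_measure set T -> \bar R} := sigma_finite_copy sf.
have iE A h : \int[m']_(x in A) h x = \int[m]_(x in A) h x by exact: eq_measure_integral.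
have inE A h : m.-integrable A h <-> m'.-integrable A h.
  by split=> /integrableP[mh hoo]; apply/integrableP; split; rewrite // ?iE// -iE.
have nuE' A : measurable A -> nu A = \int[m']_(x in A) (g x)%:E.
  by move=> mA; rewrite iE nuE.
rewrite -iE inE.
exact: charge_integral_density_sigma_finite mD bf ((inE _ _).1 ig) nuE'.
Qed.

End charge_integral_theory.

Section finite_pushforward.
Context d1 d2 (T1 : measurableType d1) (T2 : measurableType d2) (R : realType).
Variables (m : {finite_measure set T1 -> \bar R}) (phi : T1 -> T2).
Local Open Scope ereal_scope.

Definition finite_pushforward (mphi : measurable_fun setT phi) : set T2 -> \bar R :=
  pushforward m phi.

Variable mphi : measurable_fun setT phi.
Local Notation m2 := (finite_pushforward mphi).

Let mphiI A : measurable A -> measurable (phi @^-1` A).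
Proof. by move=> mA; rewrite -[X in measurable X]setTI; exact: mphi. Qed.

Let m20 : m2 set0 = 0.
Proof. by rewrite /finite_pushforward/pushforward preimage_set0 measure0. Qed.

Let m2_ge0 A : 0 <= m2 A. Proof. exact: measure_ge0. Qed.

Let m2_sigma_additive : semi_sigma_additive m2.
Proof.
move=> F mF tF mUF; rewrite /finite_pushforward/pushforward preimage_bigcup.
apply: measure_semi_sigma_additive.
- by move=> k; exact: mphiI.
- apply/trivIsetP => /= i j _ _ ij; rewrite -preimage_setI.
  by move/trivIsetP : tF => /(_ _ _ _ _ ij) ->//; rewrite preimage_set0.
- by rewrite -preimage_bigcup; exact: mphiI.
Qed.

HB.instance Definition _ := isMeasure.Build _ _ _ m2 m20 m2_ge0 m2_sigma_additive.

Let m2_fin : fin_num_fun m2.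
Proof. by move=> A mA; apply: fin_num_measure; exact: mphiI. Qed.

HB.instance Definition _ := @Measure_isFinite.Build _ _ _ m2 m2_fin.

Lemma finite_pushforwardP : exists p : {finite_measure set T2 -> \bar R},
  (forall A, p A = m (phi @^-1` A)) /\
  forall D f, measurable D -> bounded_measurable setT f ->
    \int[p]_(y in D) (f y)%:E = \int[m]_(x in phi @^-1` D) (f (phi x))%:E.
Proof.
exists m2; split => // D f mD [mf [M fM]].
apply: (integral_pushforward mphi) => //; first exact/measurable_EFinP.
apply: bounded_measurable_integrable; first exact: mphiI.
split; last by exists M => x _; exact: fM.
by apply: measurable_funTS; exact: measurableT_comp.
Qed.

End finite_pushforward.

(** The images of the Jordan parts of [nu1] need not be mutually singular, hence need not be the
    Jordan parts of [nu2]; [charge_integral_diff] accepts them all the same. *)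
Lemma charge_integral_pushforward d1 d2 (T1 : measurableType d1)
    (T2 : measurableType d2) (R : realType) (phi : T1 -> T2)
    (nu1 : {charge set T1 -> \bar R}) (nu2 : {charge set T2 -> \bar R})
    (D : set T2) (f : T2 -> R) :
  measurable_fun setT phi -> measurable D -> bounded_measurable setT f ->
  (forall A, measurable A -> nu2 A = nu1 (phi @^-1` A)) ->
  charge_integral nu2 D (EFin \o f) =
    charge_integral nu1 (phi @^-1` D) (EFin \o (f \o phi)).
Proof.
move=> mphi mD [mf [M fM]] nuE.
have [p1 [n1 [nu1E _ _]]] := jordan_measures nu1.
have mphiI A : measurable A -> measurable (phi @^-1` A).
  by move=> mA; rewrite -[X in measurable X]setTI; exact: mphi.
have bfT : bounded_measurable setT f by split => //; exists M.
have bfphi : bounded_measurable (phi @^-1` D) (f \o phi).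
  split; last by exists M => x _; exact: fM.
  by apply: measurable_funTS; exact: measurableT_comp.
have [p [pE pi]] := finite_pushforwardP p1 mphi.
have [n [nE ni]] := finite_pushforwardP n1 mphi.
rewrite (@charge_integral_diff _ _ _ nu1 p1 n1)//; last exact: mphiI.
rewrite -pi// -ni//; apply: charge_integral_diff => //.
  by split; [exact: measurable_funTS|exists M => x _; exact: fM].
by move=> A mA; rewrite nuE// pE nE nu1E//; exact: mphiI.
Qed.


(** * From positivity of integrals to positivity of densities, and back *)

Lemma ae_ge0_integral d (T : measurableType d) (R : realType)
    (m : {measure set T -> \bar R}) (D : set T) (g : T -> R) : measurable D ->
  m.-integrable D (EFin \o g) ->
  (forall A, measurable A -> A `<=` D -> (0 <= \int[m]_(x in A) (g x)%:E)%E) ->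
  {ae m, forall x, D x -> 0 <= g x}.
Proof.
move=> mD ig g0.
have mg : measurable_fun D g by apply/measurable_EFinP; exact: measurable_int ig.
pose A := D `&` [set x | g x < 0].
have mA : measurable A.
  have -> : A = D `&` g @^-1` `]-oo, 0[.
    by apply/seteqP; split=> x [Dx]; rewrite /= in_itv/=.
  exact: mg.
have AD : A `<=` D by move=> x [].
have igA : m.-integrable A (EFin \o g) by exact: integrableS ig.
have iN : (\int[m]_(x in A) (- g x)%:E = - \int[m]_(x in A) (g x)%:E)%E.
  by rewrite -mulN1e -integralZl//; apply: eq_integral => x _; rewrite /= EFinN mulN1e.
(* On the set [A] where [g < 0], the integral of [- g] is nonnegative by sign and nonpositive by
   hypothesis. *)
have iA0 : (\int[m]_(x in A) `|(EFin \o g) x| = 0)%E.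
  have -> : (\int[m]_(x in A) `|(EFin \o g) x| = \int[m]_(x in A) (- g x)%:E)%E.
    by apply: eq_integral => x; rewrite inE => -[_ gx]/=; rewrite ltr0_norm.
  apply/eqP; rewrite eq_le; apply/andP; split; first by rewrite iN oppe_le0 g0.
  by apply: integral_ge0 => x [_ /ltW gx]; rewrite lee_fin oppr_ge0.
have [/(_ iA0)] := ae_eq_integral_abs m mA (measurable_int m igA).
move=> + _; apply: filterS => x /= Ax Dx; rewrite leNgt; apply/negP => gx.
by have /(_ (conj Dx gx)) [gx0] := Ax; rewrite gx0 ltxx in gx.
Qed.

Section psd_measure_theory.
Context d (T : measurableType d) (R : realType).

Lemma ae_forall_countable (m : {measure set T -> \bar R}) (I : countType)
    (P : I -> T -> Prop) :
  (forall i, {ae m, forall x, P i x}) -> {ae m, forall x, forall i, P i x}.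
Proof.
move=> aeP.
have : {ae m, forall x, forall k : nat,
    (if unpickle k is Some i then P i x else True) : Prop}.
  by apply: ae_foralln => k; case: unpickle => [i|]; [exact: aeP|exact: aeW].
by apply: filterS => x Px i; have := Px (pickle i); rewrite pickleK.
Qed.

(** Density of rational vectors and continuity of the form. Countably many tests are what allows the
    exceptional null sets to be united in [ae_psd]. *)
Lemma quad_form_ge0_rat n (A : 'M[R]_n) :
  (forall q : 'rV[rat]_n,
    0 <= (map_mx ratr q *m A *m (map_mx ratr q)^T) 0 0) ->
  forall v : 'rV[R]_n, 0 <= (v *m A *m v^T) 0 0.
Proof.
move=> Aq v; rewrite leNgt; apply/negP => vAv.
pose F (w : 'rV[R]_n) := (w *m A *m w^T) 0 0.
have cF : continuous F.
  have -> : F = fun w => \sum_i \sum_j w 0 i * A i j * w 0 j.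
    by apply/funext => w; rewrite /F quad_formE.
  apply: continuous_sumr => i; apply: continuous_sumr => j w.
  have cX k : continuous (fun w : 'rV[R]_n => w 0 k) by exact: coord_continuous.
  exact: (continuousM (continuousM (cX i w) (@cst_continuous _ _ (A i j) w)) (cX j w)).
have /nbhs_ballP[e /= e0 eF] : nbhs v (F @^-1` [set r | r < 0]).
  by apply: cF; apply: open_nbhs_nbhs; split => //; exact: open_lt.
have Hq (i : 'I_n) : exists q : rat, `|v 0 i - ratr q| < e.
  have [q] := @rat_in_itvoo R (v 0 i - e) (v 0 i + e)
    (ltac:(by rewrite ltrD2l gtrN)).
  by rewrite in_itv/= => /andP[q1 q2]; exists q; rewrite ltr_distl ltrBlDr q2 -ltrBlDr q1.
pose q := \row_i projT1 (cid (Hq i)) : 'rV[rat]_n.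
have : ball v e (map_mx ratr q : 'rV[R]_n).
  split=> // i j; rewrite !mxE ord1 /ball/=.
  exact: (projT2 (cid (Hq j))).
by move=> /eF/=; rewrite ltNge Aq.
Qed.

Lemma integral_sum_fun (m : {measure set T -> \bar R}) (D : set T) (I : Type)
    (s : seq I) (f : I -> T -> R) : measurable D ->
  (forall i, m.-integrable D (EFin \o f i)) ->
  m.-integrable D (fun x => (\sum_(i <- s) f i x)%:E) /\
  (\int[m]_(x in D) (\sum_(i <- s) f i x)%:E =
   \sum_(i <- s) \int[m]_(x in D) (f i x)%:E)%E.
Proof.
move=> mD fi; elim: s => [|i s [IHi IHe]].
  rewrite big_nil; under eq_fun do rewrite big_nil;
  by rewrite integral0; split => //; exact: integrable0.
under eq_fun do rewrite big_cons EFinD.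
have fiE : m.-integrable D (fun x => (f i x)%:E) := fi i.
by split; [exact: integrableD|rewrite big_cons integralD// IHe].
Qed.

Lemma integral_quad_form (m : {measure set T -> \bar R}) n (A : set T)
    (G : T -> 'M[R]_n) (v : 'rV[R]_n) : measurable A ->
  (forall i j, m.-integrable A (fun x => (G x i j)%:E)) ->
  m.-integrable A (fun x => ((v *m G x *m v^T) 0 0)%:E) /\
  (\int[m]_(x in A) ((v *m G x *m v^T) 0 0)%:E =
   ((v *m (\matrix_(i, j) fine (\int[m]_(x in A) (G x i j)%:E)) *m v^T) 0 0)%:E)%E.
Proof.
move=> mA iG.
have ivG i j : m.-integrable A (EFin \o (fun x => v 0 i * G x i j * v 0 j)).
  have := integrableZl mA (v 0 i * v 0 j) (iG i j).
  by congr (m.-integrable _ _); apply/funext => x; rewrite -EFinM mulrAC.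
have ivG' i : m.-integrable A (EFin \o (fun x => \sum_j v 0 i * G x i j * v 0 j)).
  exact: (integral_sum_fun _ mA (ivG i)).1.
have -> : (fun x => ((v *m G x *m v^T) 0 0)%:E) =
    (fun x => (\sum_i \sum_j v 0 i * G x i j * v 0 j)%:E).
  by apply/funext => x; rewrite quad_formE.
have [-> ->] := integral_sum_fun (index_enum _) mA ivG'; split => //.
rewrite quad_formE -sumEFin; apply: eq_bigr => i _.
rewrite (integral_sum_fun _ mA (ivG i)).2 -sumEFin; apply: eq_bigr => j _.
rewrite [LHS](_ : _ = \int[m]_(x in A) ((v 0 i * v 0 j)%:E * (G x i j)%:E))%E.
  by rewrite integralZl// [in RHS]mxE mulrAC [RHS]EFinM fineK// integrable_fin_num.
by apply: eq_integral => x _; rewrite -EFinM mulrAC.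
Qed.

Lemma ae_psd (m : {measure set T -> \bar R}) n (D : set T) (G : T -> 'M[R]_n) :
  measurable D -> (forall i j, m.-integrable D (fun x => (G x i j)%:E)) ->
  (forall A, measurable A -> A `<=` D ->
    psd (\matrix_(i, j) fine (\int[m]_(x in A) (G x i j)%:E)%E)) ->
  {ae m, forall x, D x -> psd (G x)}.
Proof.
move=> mD iG pG.
have iGA A i j (mA : measurable A) (AD : A `<=` D) :
  m.-integrable A (fun x => (G x i j)%:E) by exact: integrableS (iG i j).
have symG : {ae m, forall x, forall ij : 'I_n * 'I_n,
    D x -> G x ij.1 ij.2 = G x ij.2 ij.1}.
  apply: ae_forall_countable => -[i j] /=.
  suff : ae_eq m D (fun x => (G x i j)%:E) (fun x => (G x j i)%:E).
    by apply: filterS => x /[apply] -[].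
  apply: integral_ae_eq => //; first exact: measurable_int (iG j i).
  move=> E ED mE; have [/matrixP/(_ j i)] := pG E mE ED.
  rewrite !mxE => ijE _.
  by rewrite -[LHS]fineK ?integrable_fin_num ?iGA// ijE fineK// integrable_fin_num ?iGA.
have qG : {ae m, forall x, forall q : 'rV[rat]_n,
    D x -> 0 <= (map_mx ratr q *m G x *m (map_mx ratr q)^T) 0 0}.
  apply: ae_forall_countable => q; move: (map_mx _ _) => v {q}.
  apply: ae_ge0_integral => //; first exact: (integral_quad_form v mD iG).1.
  move=> A mA AD; rewrite (integral_quad_form v mA (fun i j => iGA A i j mA AD)).2.
  by have [_ /(_ v)] := pG A mA AD.
apply: filterS2 symG qG => x sx qx Dx; split.
  by apply/matrixP => i j; rewrite mxE (sx (j, i)).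
by apply: quad_form_ge0_rat => q; exact: qx.
Qed.

Lemma ae_integral_ge0 (m : {measure set T -> \bar R}) (D : set T) (g : T -> R) :
  measurable D -> measurable_fun D g -> {ae m, forall x, D x -> 0 <= g x} ->
  (0 <= \int[m]_(x in D) (g x)%:E)%E.
Proof.
move=> mD mg g0.
rewrite (@ae_eq_integral _ _ _ m D (fun x => `|g x|%:E))//.
- by apply: integral_ge0 => x _; rewrite lee_fin.
- exact/measurable_EFinP.
- by apply/measurable_EFinP; exact: measurableT_comp.
- by move: g0; apply: filterS => x gx /gx g0; rewrite ger0_norm.
Qed.

(** All entries are dominated by one finite measure [m]; the double sum is then the integral of the
    trace of [H] times the density matrix [t], and a trace of a product of psd matrices is
    nonnegative. *)
Lemma psd_charge_integral_ge0 n (Gamma : 'I_n -> 'I_n -> {charge set T -> \bar R})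
    (D : set T) (H : T -> 'M[R]_n) : measurable D ->
  (forall i j, bounded_measurable D (fun x => H x i j)) ->
  (forall x, D x -> psd (H x)) ->
  (forall A, measurable A -> psd (\matrix_(i, j) fine (Gamma i j A))) ->
  (0 <= \sum_i \sum_j charge_integral (Gamma i j) D (fun x => (H x i j)%:E))%E.
Proof.
move=> mD bH pH pG.
have [m mP] := charge_dominating_measure (index_enum _)
  (fun ij : 'I_n * 'I_n => Gamma ij.1 ij.2).
have Gm i j : Gamma i j `<< m by have := mP (i, j); apply; exact: mem_index_enum.
pose t x := \matrix_(i, j) fine (Radon_Nikodym (Gamma i j) m x).
have tE i j x : (t x i j)%:E = Radon_Nikodym (Gamma i j) m x.
  by rewrite mxE fineK// Radon_Nikodym_fin_num.
have it i j : m.-integrable setT (EFin \o (fun x => t x i j)).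
  by rewrite [X in m.-integrable _ X](_ : _ = Radon_Nikodym (Gamma i j) m);
    [exact: Radon_Nikodym_integrable|apply/funext => x; exact: tE].
have GE i j A : measurable A -> Gamma i j A = (\int[m]_(x in A) (t x i j)%:E)%E.
  move=> mA; rewrite (Radon_Nikodym_integral (Gm i j))//.
  by apply: eq_integral => x _; rewrite tE.
have pt : {ae m, forall x, setT x -> psd (t x)}.
  apply: ae_psd => // A mA _; have := pG A mA.
  by congr psd; apply/matrixP => i j; rewrite !mxE GE.
have dens i j := charge_integral_density (sigma_finiteT m) mD (bH i j) (it i j) (GE i j).
have -> : (\sum_i \sum_j charge_integral (Gamma i j) D (fun x => (H x i j)%:E) =
    \int[m]_(x in D) (\sum_i \sum_j H x i j * t x i j)%:E)%E.
  rewrite (integral_sum_fun _ mD _).2; last first.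
    by move=> i; apply: (integral_sum_fun _ _ _).1 => // j; exact: (dens i j).2.
  apply: eq_bigr => i _; rewrite (integral_sum_fun _ mD _).2; last first.
    by move=> j; exact: (dens i j).2.
  by apply: eq_bigr => j _; exact: (dens i j).1.
apply: ae_integral_ge0 => //.
  apply/measurable_EFinP; apply: (measurable_int m).
  apply: (integral_sum_fun _ _ _).1 => // i.
  by apply: (integral_sum_fun _ _ _).1 => // j; exact: (dens i j).2.
move: pt; apply: filterS => x /(_ I) ptx Dx.
(* The trace pairs [H i j] with [t j i]; symmetry of [t x] exchanges the indices. *)
have [+ _] := psd_mul_tr_AGM (pH x Dx) ptx; congr (_ <= _).
apply: eq_bigr => i _; rewrite mxE; apply: eq_bigr => j _; congr (_ * _).
by have [/matrixP/(_ i j)] := ptx; rewrite mxE.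
Qed.

End psd_measure_theory.

Lemma psd_integral {d} {T : measurableType d} {R : realType}
    (m : {measure set T -> \bar R}) n (A : set T) (G : T -> 'M[R]_n) :
  measurable A -> (forall i j, m.-integrable A (fun x => (G x i j)%:E)) ->
  (forall x, A x -> psd (G x)) ->
  psd (\matrix_(i, j) fine (\int[m]_(x in A) (G x i j)%:E)%E).
Proof.
move=> mA iG pG; split.
  apply/matrixP => i j; rewrite !mxE; congr fine; apply: eq_integral => x.
  by rewrite inE => /pG[/matrixP/(_ i j)]; rewrite mxE => ->.
move=> v; rewrite -lee_fin -(integral_quad_form v mA iG).2.
by apply: integral_ge0 => x Ax; rewrite lee_fin; have [_] := pG x Ax.
Qed.

(** * The stress carried by segments *)

(** The sigma-algebra on row vectors is generated by the open sets rather than by coordinates;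
    peeling off one coordinate at a time with the measurable map [rV_cons] bridges the two. *)
Lemma measurable_fun_rV d (T : measurableType d) (R : realType) n
    (f : T -> 'rV[R]_n) :
  (forall i, measurable_fun setT (fun x => f x 0 i)) -> measurable_fun setT f.
Proof.
elim: n f => [|n IHn] f mf.
  rewrite (_ : f = cst 0); first exact: measurable_cst.
  by apply/funext => x; apply/rowP; case.
rewrite (_ : f = @rV_cons R n \o (fun x => (f x 0 0, rsubmx (f x : 'rV[R]_(1 + n))))).
  apply: measurableT_comp; first exact: rV_cons_measurable.
  apply: measurable_fun_pair; first exact: mf.
  by apply: IHn => i; under eq_fun do rewrite mxE; exact: mf.
apply/funext => x /=; apply/rowP => i; case: (unliftP 0 i) => [j|] ->.
  by rewrite (_ : lift 0 j = rshift 1 j) ?rV_consES ?mxE//; apply/val_inj.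
by rewrite rV_consE0.
Qed.

Lemma charge_pushforwardP d1 d2 (T1 : measurableType d1) (T2 : measurableType d2)
    (R : realType) (nu : {charge set T1 -> \bar R}) (phi : T1 -> T2) :
  measurable_fun setT phi ->
  exists nu2 : {charge set T2 -> \bar R}, forall A, nu2 A = nu (phi @^-1` A).
Proof. by move=> mphi; unshelve eexists (pushforward nu phi). Qed.

Lemma eq_charge_integral d (T : measurableType d) (R : realType)
    (nu : {charge set T -> \bar R}) (D : set T) (f g : T -> \bar R) :
  {in D, f =1 g} -> charge_integral nu D f = charge_integral nu D g.
Proof. by move=> fg; congr (_ - _)%E; exact: eq_integral. Qed.

Section segment_stress.
Context {R : realType} {n : nat}.
Variables (Omega : set 'rV[R]_n) (x : 'rV[R]_n) (mu : probability 'rV[R]_n R).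
Hypotheses (dO : bounded_convex_domain Omega) (Ox : Omega x).
Hypothesis mu_J : jensen_boundary Omega x mu.

Let oO : open Omega. Proof. by case: dO. Qed.
Let bO : bounded_set Omega. Proof. by case: dO. Qed.
Let cO : convex_set Omega. Proof. by case: dO. Qed.

Let T1 : Type := (measurableTypeR R * 'rV[R]_n)%type.
Let m := (@lebesgue_measure R \x mu)%E.
Let B := boundary Omega.

Lemma measurable_boundary : measurable B.
Proof.
apply: measurableD; last by apply: open_measurable_rV; exact: open_interior.
rewrite -[X in measurable X]setCK; apply: measurableC; apply: open_measurable_rV.
by apply: closed_openC; exact: closed_closure.
Qed.

(** At [t = 1] the segment reaches the boundary, so the half-open interval is what makes the stress
    carried by [Omega]. *)
Definition segment_dom : set T1 := `[0, 1[%classic `*` B.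

Definition segment_map (p : T1) : 'rV[R]_n := x + p.1 *: (p.2 - x).

(** The weight [1 - t] is that of the Taylor remainder. Extension by zero gives a density on the
    whole product space, so that the induced charges need no domain. *)
Definition segment_density (p : T1) : 'M[R]_n :=
  if p \in segment_dom then (1 - p.1) *: ((p.2 - x)^T *m (p.2 - x)) else 0.

Lemma measurable_segment_dom : measurable segment_dom.
Proof. by apply: measurableX => //; exact: measurable_boundary. Qed.

Lemma segment_dom_sub p : segment_dom p -> Omega (segment_map p).
Proof.
case: p => t y [/=]; rewrite in_itv/= => /andP[t0 t1] [cy _].
exact: convex_segment.
Qed.

Let mfst : measurable_fun setT (fun p : T1 => p.1 : R).
Proof. exact: measurable_fst. Qed.

Let mcoord i : measurable_fun setT (fun p : T1 => p.2 0 i).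
Proof.
apply: (measurableT_comp (f := fun y : 'rV[R]_n => y 0 i)) => //.
by apply: continuous_measurable_rV; exact: coord_continuous.
Qed.

Lemma measurable_segment_map : measurable_fun setT segment_map.
Proof.
apply: measurable_fun_rV => i; under eq_fun do rewrite !mxE.
apply: measurable_funD => //; apply: measurable_funM => //.
exact: measurable_funB.
Qed.

Lemma psd_segment_density p : psd (segment_density p).
Proof.
rewrite /segment_density; case: ifPn => [|_]; last first.
  by split=> [|v]; rewrite ?trmx0// mulmx0 mul0mx mxE.
rewrite inE => -[/=]; rewrite in_itv/= => /andP[_ /ltW t1] _; split=> [|v].
  by rewrite linearZ/= trmx_mul trmxK.
rewrite -scalemxAr -scalemxAl mxE; apply: mulr_ge0; first by rewrite subr_ge0.
set w := p.2 - x; rewrite mulmxA -(mulmxA _ w) mxE big_ord1.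
have -> : w *m v^T = (v *m w^T)^T by rewrite trmx_mul trmxK.
by rewrite [(_^T) _ _]mxE -expr2 sqr_ge0.
Qed.

Lemma coord_bounded : exists K : R, forall (y : 'rV[R]_n) k,
  closure Omega y -> `|y 0 k| <= K.
Proof.
have [M [_ bM]] := bounded_closure bO.
exists (M + 1) => y k cy; have : `|y| <= M + 1 by apply: bM => //; rewrite ltrDl.
apply: le_trans; rewrite [leRHS]mx_normrE.
exact: (le_bigmax _ (fun ij : 'I_1 * 'I_n => `|y ij.1 ij.2|) (0, k)).
Qed.

Lemma integrable_segment_density i j :
  m.-integrable setT (fun p => (segment_density p i j)%:E).
Proof.
have mD := measurable_segment_dom.
pose g (p : T1) := (1 - p.1) * ((p.2 0 i - x 0 i) * (p.2 0 j - x 0 j)).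
have -> : (fun p => (segment_density p i j)%:E) = (EFin \o g) \_ segment_dom.
  apply/funext => p; rewrite /segment_density /patch; case: ifPn => _.
    by rewrite mxE mxE big_ord1 !mxE.
  by rewrite mxE.
apply/(integrable_mkcond _ mD).
have [K KO] := coord_bounded.
have KB y k : B y -> `|y 0 k - x 0 k| <= K + K.
  move=> [cy _]; apply: (le_trans (ler_normB _ _)); apply: lerD; apply: KO => //.
  exact: subset_closure.
have moo : (m segment_dom < +oo)%E.
  have -> : m segment_dom = (lebesgue_measure `[0%R, 1%R[%classic * mu B)%E.
    by apply: product_measure1E => //; exact: measurable_boundary.
  rewrite lebesgue_measure_itv/= lte_fin ltr01 oppr0 adde0 mul1e.
  by case: mu_J => -> _; rewrite ltry.
apply: measurable_bounded_integrable => //.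
- apply: measurable_funTS; apply: measurable_funM; first exact: measurable_funB.
  by apply: measurable_funM; exact: measurable_funB.
- exists ((K + K) * (K + K)); split=> [|L KL p [/=]]; first exact: num_real.
  rewrite in_itv/= => /andP[t0 t1] By.
  apply: le_trans (ltW KL); rewrite /g !normrM -[leRHS]mul1r.
  apply: ler_pM => //; first by rewrite ger0_norm ?gerBl// subr_ge0 ltW.
  by apply: ler_pM => //; exact: KB.
Qed.

(** This is where the barycenter condition enters; [c] will be the gradient of the test function at
    [x]. *)
Lemma integral_gradient (c : 'I_n -> R) :
  mu.-integrable B (fun y => (\sum_i (y - x) 0 i * c i)%:E) /\
  (\int[mu]_(y in B) (\sum_i (y - x) 0 i * c i)%:E = 0)%E.
Proof.
have mB := measurable_boundary; have [_ bar] := mu_J.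
have muB : mu B = 1%E by case: mu_J.
have icoord i : mu.-integrable B (fun y => (y 0 i)%:E).
  apply: bounded_measurable_integrable => //; split.
    by apply: measurable_funTS; apply: continuous_measurable_rV; exact: coord_continuous.
  by have [K KO] := coord_bounded; exists K => y [cy _]; exact: KO.
have icst (k : R) : mu.-integrable B (fun=> k%:E).
  apply: (@bounded_measurable_integrable _ _ _ mu B (cst k)) => //; split; first exact: measurable_cst.
  by exists `|k|.
have iE i : mu.-integrable B (EFin \o (fun y => (y - x) 0 i * c i)) /\
    (\int[mu]_(y in B) ((y - x) 0 i * c i)%:E = 0)%E.
  have E y : (((y - x) 0 i * c i)%:E = (c i)%:E * ((y 0 i)%:E - (x 0 i)%:E))%E.
    by rewrite -EFinB -EFinM mulrC !mxE.
  split.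
    have : mu.-integrable B (fun y => (c i)%:E * ((y 0 i)%:E - (x 0 i)%:E))%E.
      by apply: integrableZl => //; exact: integrableB.
    by congr (mu.-integrable _ _); apply/funext => y; rewrite -E.
  under eq_integral do rewrite E.
  rewrite integralZl//; last exact: integrableB.
  rewrite integralB// bar integral_cst//.
  have -> : ((x 0 i)%:E * mu B = (x 0 i)%:E)%E by rewrite muB mule1.
  by rewrite -EFinB subrr mule0.
have [is0 is1] := integral_sum_fun (index_enum _) mB (fun i => (iE i).1).
by split => //; rewrite is1 big1// => i _; exact: (iE i).2.
Qed.

Lemma segment_stress_quad (H : 'M[R]_n) p : segment_dom p ->
  \sum_i \sum_j H i j * segment_density p i j =
  (1 - p.1) * quad H (p.2 - x) (p.2 - x).
Proof.
move=> Dp; rewrite /segment_density mem_set// /quad exchange_big/= mulr_sumr.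
apply: eq_bigr => j _; rewrite !mulr_sumr; apply: eq_bigr => i _.
by rewrite mxE mxE big_ord1 !mxE; ring.
Qed.

Lemma segment_stress_identity phi : C2_closure Omega phi ->
  (\int[m]_p ((fun p => ((1 - p.1) *
      quad (hessian phi (segment_map p)) (p.2 - x) (p.2 - x))%:E) \_ segment_dom) p =
   jensen_gap Omega x mu phi)%E.
Proof.
move=> C2phi; have [H cH HE] := hessian_extension dO C2phi.
pose K := (fun p : T1 => ((1 - p.1) *
  quad (hessian phi (segment_map p)) (p.2 - x) (p.2 - x))%:E) \_ segment_dom.
rewrite -/K.
(* The extension [H] is bounded and continuous everywhere, which gives the integrability needed for
   Fubini. *)
have KE : K = fun p => (\sum_i \sum_j H (segment_map p) i j * segment_density p i j)%:E.
  apply/funext => p; rewrite /K /patch; case: ifPn => [|pD].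
    rewrite inE => Dp; rewrite segment_stress_quad// HE//; exact: segment_dom_sub.
  rewrite big1// => i _; rewrite big1// => j _.
  by rewrite /segment_density (negPf pD) mxE mulr0.
have iK : m.-integrable setT K.
  rewrite KE; apply: (integral_sum_fun _ _ _).1 => // i.
  apply: (integral_sum_fun _ _ _).1 => // j.
  have [cHij [M HM]] := cH i j.
  have mH : measurable_fun setT (fun p => H (segment_map p) i j).
    apply: (measurableT_comp (continuous_measurable_rV cHij)).
    exact: measurable_segment_map.
  apply: (integrableMr _ mH _ (integrable_segment_density i j)) => //.
  by exists M; split=> [|L ML p _]; [exact: num_real|exact: le_trans (HM _) (ltW ML)].
(* Fubini with [t] as the inner variable: for each [y] in the boundary the inner integral is a
   Taylor remainder. *)
rewrite -(integral21_prod_meas1 iK).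
have [cphi _ _] := C2phi.
have [U cU [[M UM] uU]] := closure_continuous_extension bO cphi.
have mB := measurable_boundary.
have muB : mu B = 1%E by case: mu_J.
have [ig g0] := integral_gradient (fun i => partial i phi x).
transitivity (\int[mu]_(y in B)
    (phi y - phi x - \sum_i (y - x) 0 i * partial i phi x)%:E)%E.
  rewrite [RHS]integral_mkcond; apply: eq_integral => y _.
  rewrite /fubini_G [RHS]/patch; case: ifPn => [|yB].
    rewrite inE => -[cy yi].
    rewrite -(taylor_segment dO C2phi Ox cy) [RHS]integral_mkcond.
    apply: eq_integral => t _; rewrite /K /patch/=.
    congr (if _ then _ else _).
    by apply/idP/idP; rewrite !inE; [case|split].
  apply: integral0_eq => t _; rewrite /K /patch; case: ifPn => //.
  by rewrite inE => -[_ /=]; move/negP : yB; rewrite inE.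
have iphi : mu.-integrable B (EFin \o phi).
  apply: bounded_measurable_integrable => //; split.
    apply: (eq_measurable_fun U) => [y|].
      by rewrite inE => -[cy _]; rewrite uU// inE.
    by apply: measurable_funTS; exact: continuous_measurable_rV.
  by exists M => y [cy _]; rewrite uU// inE.
have icst (k : R) : mu.-integrable B (EFin \o cst k).
  apply: bounded_measurable_integrable => //; split; first exact: measurable_cst.
  by exists `|k|.
under eq_integral do rewrite EFinB EFinB.
rewrite integralB//; last by apply: integrableB => //; exact: icst.
rewrite g0 sube0 integralB//; last exact: icst.
rewrite integral_cst//; have -> : ((phi x)%:E * mu B = (phi x)%:E)%E by rewrite muB mule1.
by [].
Qed.

Lemma jensen_stress_exists : exists Gamma : matrix_charge R n,
  jensen_stress Omega x mu Gamma.
Proof.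
have mphi := measurable_segment_map.
pose nu i j := induced_charge (integrable_segment_density i j).
have /choice[Gam GamE] : forall ij : 'I_n * 'I_n,
    exists nu2 : {charge set 'rV[R]_n -> \bar R},
    forall A, nu2 A = (\int[m]_(p in segment_map @^-1` A)
      (segment_density p ij.1 ij.2)%:E)%E.
  by move=> ij; have [nu2 nu2E] := charge_pushforwardP (nu ij.1 ij.2) mphi; exists nu2.
have mphiI A : measurable A -> measurable (segment_map @^-1` A).
  by move=> mA; rewrite -[X in measurable X]setTI; exact: mphi.
have mO : measurable Omega by exact: open_measurable_rV.
exists (fun i j => Gam (i, j)); split.
- move=> i j A mA AO; rewrite GamE integral0_eq// => p Ap.
  rewrite /segment_density; case: ifPn => [|_]; last by rewrite mxE.
  rewrite inE => /segment_dom_sub Op.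
  by have : (A `&` Omega) (segment_map p) by []; rewrite AO.
- move=> A mA.
  rewrite (_ : \matrix_(i, j) _ =
      \matrix_(i, j) fine (\int[m]_(p in segment_map @^-1` A)
        (segment_density p i j)%:E)%E).
    apply: psd_integral; first exact: mphiI.
      move=> i j; apply: integrableS (integrable_segment_density i j) => //.
      exact: mphiI.
    by move=> p _; exact: psd_segment_density.
  by apply/matrixP => i j; rewrite !mxE GamE.
move=> phi C2phi; have [H cH HE] := hessian_extension dO C2phi.
have mD := mphiI _ mO.
have bH i j : bounded_measurable setT (fun y => H y i j).
  have [cHij [M HM]] := cH i j; split; first exact: continuous_measurable_rV.
  by exists M => y _; exact: HM.
have bHphi i j : bounded_measurable (segment_map @^-1` Omega)
    (fun p => H (segment_map p) i j).
  have [mH [M HM]] := bH i j; split; last by exists M => p _; exact: HM.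
  apply: measurable_funTS; exact: (measurableT_comp mH).
have sfm : sigma_finite setT m.
  exact: lebesgue_integral_fubini.product_measure_sigma_finite_subproof.
have dens i j := charge_integral_density sfm mD (bHphi i j)
  (integrable_segment_density i j) (fun A _ => erefl (nu i j A)).
rewrite -segment_stress_identity//.
(* The preimage of [Omega] may be larger than [segment_dom]; the density vanishes on the
   difference. *)
transitivity (\int[m]_(p in segment_map @^-1` Omega)
    (\sum_i \sum_j H (segment_map p) i j * segment_density p i j)%:E)%E.
  rewrite [RHS]integral_mkcond; apply: eq_integral => p _.
  rewrite /patch; case: ifPn => [|pD].
    rewrite inE => Dp; rewrite mem_set; last exact: segment_dom_sub.
    by rewrite segment_stress_quad// HE//; exact: segment_dom_sub.
  case: ifPn => // _; rewrite big1// => i _; rewrite big1// => j _.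
  by rewrite /segment_density (negPf pD) mxE mulr0.
rewrite (integral_sum_fun _ mD _).2; last first.
  by move=> i; apply: (integral_sum_fun _ _ _).1 => // j; exact: (dens i j).2.
apply: eq_bigr => i _; rewrite (integral_sum_fun _ mD _).2; last first.
  by move=> j; exact: (dens i j).2.
apply: eq_bigr => j _.
(* The change of variables asks for a function bounded and measurable on the whole space, hence [H]
   in place of the Hessian. *)
rewrite -(dens i j).1 (@eq_charge_integral _ _ _ _ _ _ (EFin \o (fun y => H y i j))).
  by rewrite (charge_integral_pushforward mphi mO (bH i j) (nu1 := nu i j)).
by move=> y; rewrite inE => Oy; rewrite HE.
Qed.

End segment_stress.

(** * The lower bound *)

Section stress_bound.
Context {R : realType} {n : nat}.
Variables (Omega : set 'rV[R]_n) (x : 'rV[R]_n) (mu : probability 'rV[R]_n R).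
Variables (Gamma : matrix_charge R n) (G : 'rV[R]_n -> 'M[R]_n).
Variable (Gammas : matrix_charge R n).
Hypothesis dO : bounded_convex_domain Omega.
Hypothesis stress : jensen_stress Omega x mu Gamma.
Hypothesis decomp : lebesgue_decomposition Omega Gamma G Gammas.

Let lambda := lebesgue_rV R n.

Let oO : open Omega. Proof. by case: dO. Qed.

Let mO : measurable Omega. Proof. exact: open_measurable_rV. Qed.

Let iG i j : lambda.-integrable Omega (fun y => (G y i j)%:E).
Proof. by case: decomp. Qed.

(** On subsets of the null set [N] the absolutely continuous part vanishes, so [Gammas A] is [Gamma]
    on [A] intersected with [N]. *)
Lemma psd_singular_part : psd_measure Gammas.
Proof.
have [_ pG _] := stress; have [_ [N [mN N0 sN]] dec] := decomp.
move=> A mA; have mAN : measurable (A `&` N) by exact: measurableI.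
have -> : \matrix_(i, j) fine (Gammas i j A) = \matrix_(i, j) fine (Gamma i j (A `&` N)).
  apply/matrixP => i j; rewrite !mxE; congr fine.
  rewrite dec// null_set_integral ?add0e.
  - rewrite (chargeDI (Gammas i j) mA mN) (sN i j (A `\` N)) ?add0e//.
      exact: measurableD.
    by rewrite setDE -setIA setICl setI0.
  - exact: measurableI.
  - apply: measurable_funS (measurable_int _ (iG i j)) => //.
  - by apply: subset_measure0 N0 => // [|y [[_ ]]//]; exact: measurableI.
exact: pG.
Qed.

(** Dually, off [N] the singular part vanishes while removing [N] does not change the integral of
    [G], so that integral over [A] is [Gamma] on [A] without [N]. *)
Lemma ae_psd_density : {ae lambda, forall y, Omega y -> psd (G y)}.
Proof.
have [_ pG _] := stress; have [_ [N [mN N0 sN]] dec] := decomp.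
apply: ae_psd => // A mA AO; have mAN : measurable (A `\` N) by exact: measurableD.
have -> : \matrix_(i, j) fine (\int[lambda]_(y in A) (G y i j)%:E)%E =
    \matrix_(i, j) fine (Gamma i j (A `\` N)).
  apply/matrixP => i j; rewrite !mxE; congr fine.
  rewrite dec// sN ?adde0//; last by rewrite setDE -setIA setICl setI0.
  rewrite (negligible_integral mN)//; last exact: integrableS (iG i j).
  by congr integral; apply/esym/setIidPl => y [/AO].
exact: pG.
Qed.

Section test_function.
Variable u : 'rV[R]_n -> R.
Hypothesis uC2 : C2_closure Omega u.

Let bH i j : bounded_measurable Omega (fun y => hessian u y i j).
Proof.
have [H cH HE] := hessian_extension dO uC2; have [cHij [M HM]] := cH i j; split.
  apply: (eq_measurable_fun (fun y => H y i j)) => [y|].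
    by rewrite inE => Oy; rewrite HE.
  by apply: measurable_funTS; exact: continuous_measurable_rV.
by exists M => y Oy; rewrite HE.
Qed.

Let density_charge (i j : 'I_n) : exists nu : {charge set 'rV[R]_n -> \bar R},
  [/\ forall A, measurable A -> Gamma i j A = (nu A + Gammas i j A)%E,
      charge_integral nu Omega (fun y => (hessian u y i j)%:E) =
        (\int[lambda]_(y in Omega) (hessian u y i j * G y i j)%:E)%E &
      lambda.-integrable Omega (fun y => (hessian u y i j * G y i j)%:E)].
Proof.
have [_ _ dec] := decomp.
have ig : lambda.-integrable setT (EFin \o ((fun y => G y i j) \_ Omega)).
  by rewrite -restrict_EFin; apply/(integrable_mkcond _ mO); exact: iG.
have GO : {in Omega, (fun y => G y i j) \_ Omega =1 (fun y => G y i j)}.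
  by move=> y yO; rewrite patchE yO.
have [|dE di] := charge_integral_density (nu := induced_charge ig)
  (sigma_finiteT lambda) mO (bH i j) ig; first by [].
exists (induced_charge ig); split.
- move=> A mA; rewrite dec//; congr (_ + _)%E.
  rewrite integral_mkcondr; apply: eq_integral => y _.
  by rewrite restrict_EFin.
- by rewrite [LHS]dE; apply: eq_integral => y yO; rewrite GO.
- by apply: eq_integrable di => // y yO; rewrite GO.
Qed.

(** The gap is the integral of the trace against [G] plus the contribution of [Gammas], which is
    nonnegative because the Hessian is psd, and is dropped. *)
Lemma stress_trace_le_gap :
  (forall y, Omega y -> psd (hessian u y)) ->
  lambda.-integrable Omega
    (fun y => (\sum_i \sum_j hessian u y i j * G y i j)%:E) /\
  (\int[lambda]_(y in Omega) (\sum_i \sum_j hessian u y i j * G y i j)%:E <=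
   jensen_gap Omega x mu u)%E.
Proof.
move=> pH; have [_ _ ->//] := stress.
have /choice[nu nuP] : forall ij : 'I_n * 'I_n, _ := fun ij => density_charge ij.1 ij.2.
have iHG i j : lambda.-integrable Omega (fun y => (hessian u y i j * G y i j)%:E).
  by have [_ _] := nuP (i, j).
have iHGs i : lambda.-integrable Omega
    (EFin \o (fun y => \sum_j hessian u y i j * G y i j)).
  exact: (integral_sum_fun _ mO (iHG i)).1.
have [i0 ->] := integral_sum_fun (index_enum _) mO iHGs; split => //.
rewrite [leRHS](_ : _ = \sum_i \int[lambda]_(y in Omega)
      (\sum_j hessian u y i j * G y i j)%:E +
    \sum_i \sum_j charge_integral (Gammas i j) Omega
      (fun y => (hessian u y i j)%:E))%E.
  rewrite leeDl//; apply: (psd_charge_integral_ge0 mO bH pH).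
  exact: psd_singular_part.
rewrite -big_split; apply: eq_bigr => i _ /=.
rewrite (integral_sum_fun _ mO (iHG i)).2 -big_split; apply: eq_bigr => j _ /=.
have [GE <- _] := nuP (i, j).
exact: (charge_integral_add mO (bH i j) GE).
Qed.

Lemma measurable_det_density : measurable_fun Omega (fun y => \det (G y)).
Proof.
apply: measurable_sum => s; apply: measurable_funM => //.
apply: measurable_prod => i _; apply/measurable_EFinP.
exact: (measurable_int lambda (iG _ _)).
Qed.

Lemma stress_bound (f : 'rV[R]_n -> R) : (0 < n)%N ->
  {within closure Omega, continuous f} -> {in closure Omega, forall y, 0 <= f y} ->
  convex_function (closure Omega) u ->
  {in Omega, forall y, f y <= \det (hessian u y)} ->
  (n%:R%:E * \int[lambda]_(y in Omega)
      (f y `^ n%:R^-1 * \det (G y) `^ n%:R^-1)%:E <=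
   jensen_gap Omega x mu u)%E.
Proof.
move=> n0 cf f0 cu fdet.
have pH y : Omega y -> psd (hessian u y) by exact: convex_hessian_psd.
have [iT leT] := stress_trace_le_gap pH; apply: le_trans leT.
have mT : measurable_fun Omega (fun y => \sum_i \sum_j hessian u y i j * G y i j).
  by apply/measurable_EFinP; exact: (measurable_int lambda iT).
have mf : measurable_fun Omega f.
  have bO : bounded_set Omega by case: dO.
  have [g cg [_ gE]] := closure_continuous_extension bO cf.
  apply: (eq_measurable_fun g) => [y|].
    by rewrite inE => /subset_closure cy; rewrite gE// inE.
  by apply: measurable_funTS; exact: continuous_measurable_rV.
pose h y := f y `^ n%:R^-1 * \det (G y) `^ n%:R^-1.
have h0 y : 0 <= h y by rewrite mulr_ge0// powR_ge0.
have mh : measurable_fun Omega h.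
  apply: measurable_funM; apply: (measurableT_comp (measurable_powR n%:R^-1)) => //.
  exact: measurable_det_density.
have trE : {ae lambda, forall y, Omega y -> [/\ psd (G y) &
    n%:R * h y <= \sum_i \sum_j hessian u y i j * G y i j]}.
  move: ae_psd_density; apply: filterS => y pGy Oy; have pG := pGy Oy; split => //.
  have -> : \sum_i \sum_j hessian u y i j * G y i j = \tr (hessian u y *m G y).
    apply: eq_bigr => i _; rewrite mxE; apply: eq_bigr => j _; congr (_ * _).
    by have [/matrixP/(_ i j)] := pG; rewrite mxE.
  apply: psd_mul_tr_ge_powR => //; first exact: pH.
  by rewrite f0 ?fdet ?inE//; exact: subset_closure.
rewrite -ge0_integralZl//; last 2 first.
- exact/measurable_EFinP.
- by move=> y _; rewrite lee_fin; exact: h0.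
(* The contraction is nonnegative only almost everywhere. Its absolute value has the same integral
   and is nonnegative at every point, as the comparison of integrals below uses. *)
rewrite (@ae_eq_integral _ _ _ lambda Omega
  (fun y => `|\sum_i \sum_j hessian u y i j * G y i j|%:E)
  (fun y => (\sum_i \sum_j hessian u y i j * G y i j)%:E))//; last 3 first.
- by apply/measurable_EFinP.
- by apply/measurable_EFinP; exact: measurableT_comp.
- move: trE; apply: filterS => y /[apply] -[_ hy]; rewrite ger0_norm//.
  by apply: le_trans hy; rewrite mulr_ge0.
apply: ae_ge0_le_integral => //.
- by move=> y _; rewrite -EFinM lee_fin mulr_ge0//; exact: h0.
- by apply: measurable_funeM; exact/measurable_EFinP.
- by apply/measurable_EFinP; exact: measurableT_comp.
- move: trE; apply: filterS => y /[apply] -[_ hy].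
  by rewrite -EFinM lee_fin (le_trans hy)// ler_norm.
Qed.

End test_function.

End stress_bound.

Theorem proposition4p5 (R : realType) (n : nat) (n_gt0 : (0 < n)%N)
    (Omega : set 'rV[R]_n) (Omega_dom : bounded_convex_domain Omega)
    (x : 'rV[R]_n) (Omegax : Omega x)
    (mu : probability 'rV[R]_n R) (mu_J : jensen_boundary Omega x mu)
    (f : 'rV[R]_n -> R) (f_cont : {within closure Omega, continuous f})
    (f_ge0 : {in closure Omega, forall y, 0 <= f y}) :
  (exists Gamma : matrix_charge R n, jensen_stress Omega x mu Gamma) /\
  forall (Gamma : matrix_charge R n) (G : 'rV[R]_n -> 'M[R]_n)
    (Gammas : matrix_charge R n),
    jensen_stress Omega x mu Gamma ->
    lebesgue_decomposition Omega Gamma G Gammas ->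
    let bound := (n%:R%:E * \int[lebesgue_rV R n]_(y in Omega)
      (f y `^ n%:R^-1 * \det (G y) `^ n%:R^-1)%:E)%E in
    (forall u : 'rV[R]_n -> R, C2_closure Omega u ->
      convex_function (closure Omega) u ->
      {in Omega, forall y, f y <= \det (hessian u y)} ->
      (bound <= \int[mu]_(y in boundary Omega) (u y)%:E - (u x)%:E)%E) /\
    (bound <= smooth_deficit Omega x mu f)%E.
Proof.
split=> [|Gamma G Gammas stress decomp bound]; first exact: jensen_stress_exists.
have gap_ge u : C2_closure Omega u -> convex_function (closure Omega) u ->
    {in Omega, forall y, f y <= \det (hessian u y)} ->
    (bound <= jensen_gap Omega x mu u)%E.
  by move=> *; exact: (stress_bound Omega_dom stress decomp).
split; first exact: gap_ge.
by apply: le_ereal_inf_tmp => _ [u [uC2 cu fu] <-]; exact: gap_ge.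
Qed.
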